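(* Let $\widetilde{G}$ be any connected covering Lie group of $SL_2(\mathbb{R})$ (including $SL_2(\mathbb{R})$ itself and its universal cover), with Lie algebra $\mathfrak{sl}_2$ and basis $\{a,b,c\}$ satisfying $[b,a]=c$, $[a,c]=2a$, $[b,c]=-2b$. Consider on $\widetilde G$ the system $\dot q(t)=q(t)\big(a+u_0(t)\,b\big)$ with a real-valued piecewise constant control $u_0$. Then $b$ and $c$ are good Lie brackets for this system, and for every $t_1\ge 0$ the element $e^{t_1(a-b)}$ is small-time approximately reachable. Moreover, if $\widetilde G$ is not the universal cover, this system is small-time controllable on $\widetilde G$.
   Context: For a left-invariant system $\dot q=q(a_0+\sum_i u_ib_i)$ on a connected Lie group $G$ with piecewise constant controls, $q(u,t)$ denotes the solution from the identity. $\mathcal{A}_{st}$ is the set of $q\in G$ such that for every $T>0$ there exist $\tau\in[0,T]$ and a piecewise constant control $u$ on $[0,\tau]$ with $q(u,\tau)=q$. An element is small-time approximately reachable if it lies in the closure $\overline{\mathcal{A}_{st}}$; $X$ in the Lie algebra is a good Lie bracket if $e^{vX}\in\overline{\mathcal{A}_{st}}$ for every $v\in\mathbb{R}$. The system is small-time controllable if $\mathcal{A}_{st}=G$. *)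

(* Defs.v *)
From HB Require Import structures.
From mathcomp Require Import all_boot all_order all_algebra.
From mathcomp Require Import all_classical all_reals all_analysis.
Set Implicit Arguments. Unset Strict Implicit. Unset Printing Implicit Defensive.
Import Order.TTheory GRing.Theory Num.Theory.
Import numFieldNormedType.Exports.
Local Open Scope classical_set_scope.
Local Open Scope ring_scope.

Section Defs.
Variable R : realType.

Definition expm (A : 'M[R]_2) : 'M[R]_2 :=
  lim ((fun n : nat => \sum_(0 <= k < n) ((k`!)%:R^-1 : R) *: A ^+ k) @ \oo).

Definition lieb (x y : 'M[R]_2) : 'M[R]_2 := x * y - y * x.

Definition SL2 : set 'M[R]_2 := [set M | \det M = 1].

Definition sl2_basis (a b c : 'M[R]_2) : Prop :=
  [/\ \tr a = 0, \tr b = 0 & \tr c = 0] /\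
  (forall x y z : R, x *: a + y *: b + z *: c = 0 -> [/\ x = 0, y = 0 & z = 0]) /\
  [/\ lieb b a = c, lieb a c = 2%:R *: a & lieb b c = - (2%:R *: b)].

Variable G : topologicalType.
Variables (mul : G -> G -> G) (inv : G -> G) (e : G).

Definition topological_group : Prop :=
  [/\ (forall x y z, mul x (mul y z) = mul (mul x y) z),
      (forall x, mul e x = x /\ mul x e = x),
      (forall x, mul (inv x) x = e /\ mul x (inv x) = e),
      continuous (fun xy : G * G => mul xy.1 xy.2) & continuous inv].

Definition covering_hom_SL2 (p : G -> 'M[R]_2) : Prop :=
  [/\ (forall g, SL2 (p g)),
      (forall M, SL2 M -> exists g, p g = M),
      (forall x y, p (mul x y) = p x * p y) & p e = 1] /\
  continuous p /\
      (forall M, SL2 M -> exists U : set 'M[R]_2, open U /\ U M /\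
         exists (I : Type) (V : I -> set G),
           [/\ (forall i, open (V i)),
               p @^-1` U = \bigcup_i V i &
               (forall i j, i <> j -> V i `&` V j = set0)] /\
           [/\
               (forall i x y, V i x -> V i y -> p x = p y -> x = y),
               (forall i, p @` V i = U `&` SL2) &
               (forall i W, open W -> W `<=` V i ->
                  exists U', open U' /\ p @` W = U' `&` SL2)]).

Variable p : G -> 'M[R]_2.

(* g = e^X in G: the time-1 value of the continuous lift through the
   identity of the one-parameter subgroup t |-> expm (t X) of SL_2(R) *)
Definition is_expG (X : 'M[R]_2) (g : G) : Prop :=
  exists gam : R -> G, [/\ continuous gam, gam 0 = e,
     (forall t, p (gam t) = expm (t *: X)) & gam 1 = g].

(* endpoint of the trajectory of  q' = q (a + u b)  from e under a piecewise
   constant control given as a list of pieces (duration t, value u, e^{t(a+ub)}),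
   total duration at most T *)
Definition reach_le (a b : 'M[R]_2) (T : R) (q : G) : Prop :=
  exists s : seq (R * R * G),
    [/\ (forall x, x \in s -> 0 <= x.1.1 /\ is_expG (x.1.1 *: (a + x.1.2 *: b)) x.2),
        \sum_(x <- s) x.1.1 <= T &
        q = foldr (fun x acc => mul x.2 acc) e s].

Definition Ast (a b : 'M[R]_2) : set G :=
  [set q | forall T : R, 0 < T -> reach_le a b T q].

Definition st_approx_reachable (a b : 'M[R]_2) (q : G) : Prop :=
  closure (Ast a b) q.

Definition good_bracket (a b X : 'M[R]_2) : Prop :=
  forall v : R, forall g, is_expG (v *: X) g -> st_approx_reachable a b g.

Definition st_controllable (a b : 'M[R]_2) : Prop := Ast a b = setT.

End Defs.

Definition simply_connected {R : realType} (G : topologicalType) : Prop :=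
  forall gam : R -> G, {within `[0%R, 1%R], continuous gam} -> gam 0%R = gam 1%R ->
  exists H : R * R -> G,
    [/\ {within `[0%R, 1%R] `*` `[0%R, 1%R], continuous H},
        (forall s, H (s, 0%R) = gam s),
        (forall s, H (s, 1%R) = gam 0%R) &
        (forall t, H (0%R, t) = gam 0%R /\ H (1%R, t) = gam 0%R)].

(* Main.v *)
(** From the brackets one gets [a^2 = b^2 = 0] and [ab + ba = 1], so in the
    basis [ab, a, b, ba] of the 2x2 matrices [a = E12], [b = E21] and
    [c = diag(-1, 1)].  Write A, B, C, K for the lifts to G of the one-parameter
    subgroups of [a], [b], [c], [a - b], and E for the intersection over T > 0 of
    the closures of the sets of points reachable in time at most T; E is a closed
    semigroup.

    Large controls applied for a short time give B(v) in E for every v.  The identity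
    B((e^k-1)/t) A(t) B((e^-k-1)/t) = C(k) A(t e^k) and t -> 0 give C(k) in E;
    conjugating by C rescales A, so A(s) is in E for all s >= 0, and the Gauss
    decomposition of K gives K(t) in E for t >= 0.

    To pass from E to the closure of A_st: the set reachable in time at most T
    has interior points y arbitrarily close to e, and closure times interior is
    reachable, so for g in E and d > 0 one writes
    g A(d) = (g A(d) y^-1) y, where A(d) y^-1 = B A B is again in E.  Hence
    g A(d) is in A_st, and d -> 0.

    The Iwasawa decomposition K C B covers G by connectedness.  If K is injective
    then it identifies G with R^3, which is simply connected; otherwise K is
    periodic, so all of K, hence all of G, lies in E, and the interior points
    turn E = G into A_st = G. *)
Require Import Defs.
From HB Require Import structures.
From mathcomp Require Import all_boot all_order all_algebra.
From mathcomp Require Import all_classical all_reals all_analysis.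
From mathcomp Require Import ring lra.
Import Order.TTheory GRing.Theory Num.Theory.
Import numFieldNormedType.Exports.
Local Open Scope classical_set_scope.
Local Open Scope ring_scope.
Set Implicit Arguments.
Unset Strict Implicit.
Unset Printing Implicit Defensive.

Lemma cvg_comp_at {T : Type} {U V : topologicalType} (h : U -> V) (F : set_system T)
    {FF : Filter F} (f : T -> U) (y : U) :
  {for y, continuous h} -> f @ F --> y -> (fun t => h (f t)) @ F --> h y.
Proof. by move=> hc fy; exact: (cvg_comp _ _ fy hc). Qed.

Arguments cvg_comp_at {T U V} h {F FF f y}.

(** * One-parameter subgroups of SL2 *)

Section Quadruples.
Variable R : realType.
Local Notation quad := (R * R * R * R)%type.

(* [(x, y, z, w)] stands for the matrix with rows [(x, y)] and [(z, w)]. *)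
Definition q11 (M : quad) : R := M.1.1.1.
Definition q12 (M : quad) : R := M.1.1.2.
Definition q21 (M : quad) : R := M.1.2.
Definition q22 (M : quad) : R := M.2.
Definition qmul (M N : quad) : quad :=
  (q11 M * q11 N + q12 M * q21 N, q11 M * q12 N + q12 M * q22 N,
   q21 M * q11 N + q22 M * q21 N, q21 M * q12 N + q22 M * q22 N).
Definition qone : quad := (1, 0, 0, 1).
Definition qdet (M : quad) : R := q11 M * q22 M - q12 M * q21 M.
Definition qadj (M : quad) : quad := (q22 M, - q12 M, - q21 M, q11 M).

Lemma quadE (a b c d : R) :
  (q11 (a, b, c, d) = a) * (q12 (a, b, c, d) = b) *
  (q21 (a, b, c, d) = c) * (q22 (a, b, c, d) = d).
Proof. by []. Qed.

Lemma q11_continuous : continuous q11.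
Proof. by move=> M; exact: (cvg_comp _ _ (cvg_comp _ _ cvg_fst cvg_fst) cvg_fst). Qed.

Lemma q12_continuous : continuous q12.
Proof. by move=> M; exact: (cvg_comp _ _ (cvg_comp _ _ cvg_fst cvg_fst) cvg_snd). Qed.

Lemma q21_continuous : continuous q21.
Proof. by move=> M; exact: (cvg_comp _ _ cvg_fst cvg_snd). Qed.

Lemma q22_continuous : continuous q22.
Proof. by move=> M; exact: cvg_snd. Qed.

Lemma quad_cvg {T : Type} (F : set_system T) {FF : Filter F} (x y z w : T -> R)
    (a b c d : R) :
  x @ F --> a -> y @ F --> b -> z @ F --> c -> w @ F --> d ->
  (fun t => (x t, y t, z t, w t)) @ F --> (a, b, c, d).
Proof.
move=> xa yb zc wd.
exact: (cvg_pair (cvg_pair (cvg_pair xa yb) zc) wd).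
Qed.

Lemma triple_cvg {T : Type} (F : set_system T) {FF : Filter F} (x y z : T -> R)
    (a b c : R) :
  x @ F --> a -> y @ F --> b -> z @ F --> c ->
  (fun t => (x t, y t, z t)) @ F --> (a, b, c).
Proof. by move=> xa yb zc; exact: (cvg_pair (cvg_pair xa yb) zc). Qed.

Lemma quad_eq (M N : quad) :
  q11 M = q11 N -> q12 M = q12 N -> q21 M = q21 N -> q22 M = q22 N -> M = N.
Proof.
by move: M N => [[[? ?] ?] ?] [[[? ?] ?] ?]; rewrite /q11 /q12 /q21 /q22 /= => -> -> -> ->.
Qed.

Lemma qmulA M N P : qmul M (qmul N P) = qmul (qmul M N) P.
Proof. by apply: quad_eq; rewrite /qmul /q11 /q12 /q21 /q22 /=; ring. Qed.

Lemma qmul1 M : qmul M qone = M.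
Proof. by apply: quad_eq; rewrite /qmul /q11 /q12 /q21 /q22 /=; ring. Qed.

Lemma qmul_adj M : qdet M = 1 -> qmul M (qadj M) = qone.
Proof.
move=> d1; apply: quad_eq; rewrite /qmul /qadj /qone /q11 /q12 /q21 /q22 /=;
  move: d1; rewrite /qdet /q11 /q12 /q21 /q22; lra.
Qed.

Definition upperm (t : R) : quad := (1, t, 0, 1).
Definition lowerm (t : R) : quad := (1, 0, t, 1).
Definition diagm (t : R) : quad := (expR (- t), 0, 0, expR t).
(** [ellm w t] and [hypm w t] are the exponentials of [t (w^-1 a - w b)] and [t (w^-1 a + w b)]:
    constant controls [- w ^+ 2] and [w ^+ 2], with time rescaled so that the generator squares to
    -1 or 1. *)
Definition ellm (w t : R) : quad := (cos t, sin t / w, - (w * sin t), cos t).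
Definition rotm (t : R) : quad := (cos t, sin t, - sin t, cos t).
Definition ch (t : R) : R := (expR t + expR (- t)) / 2.
Definition sh (t : R) : R := (expR t - expR (- t)) / 2.
Definition hypm (w t : R) : quad := (ch t, sh t / w, w * sh t, ch t).

Lemma expRN_continuous : continuous (fun t : R => expR (- t)).
Proof.
by move=> t; apply: (cvg_comp_at expR); [exact: continuous_expR|exact: cvgN].
Qed.

Lemma ch_continuous : continuous ch.
Proof.
move=> t; apply: cvgM; last exact: cvg_cst.
by apply: cvgD; [exact: continuous_expR|exact: expRN_continuous].
Qed.

Lemma sh_continuous : continuous sh.
Proof.
move=> t; apply: cvgM; last exact: cvg_cst.
by apply: cvgB; [exact: continuous_expR|exact: expRN_continuous].
Qed.

Lemma expRVN (t : R) : expR t * expR (- t) = 1.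
Proof. by rewrite -expRD subrr expR0. Qed.

Lemma ch2Bsh2 t : ch t ^+ 2 - sh t ^+ 2 = 1.
Proof. by rewrite /ch /sh -[RHS](expRVN t); field. Qed.

Lemma ch_gt0 t : 0 < ch t.
Proof. by rewrite divr_gt0// addr_gt0// expR_gt0. Qed.

Lemma chD s t : ch (s + t) = ch s * ch t + sh s * sh t.
Proof. by rewrite /ch /sh opprD !expRD; field. Qed.

Lemma shD s t : sh (s + t) = sh s * ch t + ch s * sh t.
Proof. by rewrite /ch /sh opprD !expRD; field. Qed.

Lemma ch0 : ch 0 = 1.
Proof. by rewrite /ch oppr0 expR0; field. Qed.

Lemma sh0 : sh 0 = 0.
Proof. by rewrite /sh oppr0 subrr mul0r. Qed.

Definition one_param (rho : R -> quad) :=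
  [/\ continuous rho, rho 0 = qone, forall t, qdet (rho t) = 1 &
      forall s t, rho (s + t) = qmul (rho s) (rho t)].

Lemma one_param_upperm : one_param upperm.
Proof.
split=> //.
- by move=> t; apply: quad_cvg; (exact: cvg_cst || exact: cvg_id).
- by move=> t; rewrite /qdet /q11 /q12 /q21 /q22 /=; ring.
- by move=> s t; apply: quad_eq; rewrite /qmul /q11 /q12 /q21 /q22 /=; ring.
Qed.

Lemma one_param_lowerm : one_param lowerm.
Proof.
split=> //.
- by move=> t; apply: quad_cvg; (exact: cvg_cst || exact: cvg_id).
- by move=> t; rewrite /qdet /q11 /q12 /q21 /q22 /=; ring.
- by move=> s t; apply: quad_eq; rewrite /qmul /q11 /q12 /q21 /q22 /=; ring.
Qed.

Lemma one_param_diagm : one_param diagm.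
Proof.
split.
- move=> t; apply: quad_cvg; try exact: cvg_cst; last exact: continuous_expR.
  exact: expRN_continuous.
- by rewrite /diagm oppr0 expR0.
- by move=> t; rewrite /qdet /q11 /q12 /q21 /q22 /= mulr0 subr0 mulrC expRVN.
- by move=> s t; apply: quad_eq; rewrite /qmul /q11 /q12 /q21 /q22 /= ?opprD ?expRD; ring.
Qed.

Lemma one_param_ellm w : w != 0 -> one_param (ellm w).
Proof.
move=> w0; split.
- move=> t; apply: quad_cvg; try exact: continuous_cos.
    by apply: cvgM; [exact: continuous_sin|exact: cvg_cst].
  by apply: cvgN; apply: cvgM; [exact: cvg_cst|exact: continuous_sin].
- by rewrite /ellm cos0 sin0 mul0r mulr0 oppr0.
- by move=> t; rewrite /qdet /q11 /q12 /q21 /q22 /= -[RHS](cos2Dsin2 t); field.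
- by move=> s t; apply: quad_eq; rewrite /qmul /q11 /q12 /q21 /q22 /= ?cosD ?sinD; field.
Qed.

Lemma rotmE : rotm = ellm 1.
Proof. by apply/funext => t; rewrite /ellm divr1 mul1r. Qed.

Lemma one_param_rotm : one_param rotm.
Proof. by rewrite rotmE; apply: one_param_ellm; exact: oner_neq0. Qed.

Lemma one_param_hypm w : w != 0 -> one_param (hypm w).
Proof.
move=> w0; split.
- move=> t; apply: quad_cvg; try exact: ch_continuous.
    by apply: cvgM; [exact: sh_continuous|exact: cvg_cst].
  by apply: cvgM; [exact: cvg_cst|exact: sh_continuous].
- by rewrite /hypm ch0 sh0 mul0r mulr0.
- by move=> t; rewrite /qdet /q11 /q12 /q21 /q22 /= -[RHS](ch2Bsh2 t); field.
- by move=> s t; apply: quad_eq; rewrite /qmul /q11 /q12 /q21 /q22 /= ?chD ?shD; field.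
Qed.

End Quadruples.

Arguments qone {R}.

(** * Lifting through the covering *)

Lemma closure_cvg_near {X : Type} {T : topologicalType} (F : set_system X) {FF : ProperFilter F}
    (f : X -> T) (A : set T) (y : T) :
  f @ F --> y -> (\forall x \near F, A (f x)) -> closure A y.
Proof.
move=> fy FA B By.
have /filter_ex[x [Afx Bfx]] : \forall x \near F, A (f x) /\ B (f x).
  by apply: filterI => //; exact: fy.
by exists (f x).
Qed.

Lemma near_norm_lt (R : realType) (x u : R) : `|x| < u -> \forall t \near x, `|t| < u.
Proof. exact: (@cvgr_norm_lt _ R _ _ _ (fun t : R => t) x cvg_id u). Qed.

Lemma near_dist_lt (R : realType) (x u : R) : 0 < u -> \forall t \near x, `|t - x| < u.
Proof.
move=> u0; have h := @cvgr_dist_lt _ R _ _ _ (fun t : R => t) x cvg_id u u0.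
by near=> t; rewrite distrC; near: t; exact: h.
Unshelve. all: end_near. Qed.

Section TopGroup.
Variables (G : topologicalType) (mul : G -> G -> G) (inv : G -> G) (e : G).
Hypothesis tg : topological_group mul inv e.

Lemma tgA x y z : mul x (mul y z) = mul (mul x y) z. Proof. by case: tg. Qed.
Lemma tg1l x : mul e x = x. Proof. by case: tg => _ /(_ x)[]. Qed.
Lemma tg1r x : mul x e = x. Proof. by case: tg => _ /(_ x)[]. Qed.
Lemma tgVl x : mul (inv x) x = e. Proof. by case: tg => _ _ /(_ x)[]. Qed.
Lemma tgVr x : mul x (inv x) = e. Proof. by case: tg => _ _ /(_ x)[]. Qed.
Lemma tgKV x y : mul (mul y (inv x)) x = y. Proof. by rewrite -tgA tgVl tg1r. Qed.
Lemma tgVK x y : mul x (mul (inv x) y) = y. Proof. by rewrite tgA tgVr tg1l. Qed.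
Lemma tgVKl x y : mul (inv x) (mul x y) = y. Proof. by rewrite tgA tgVl tg1l. Qed.

Lemma tg_eqV x y : mul (inv x) y = e -> y = x.
Proof. by move=> h; rewrite -(tgVK x y) h tg1r. Qed.

Lemma cvg_tgmul {T : Type} (F : set_system T) {FF : Filter F} (f g : T -> G) (x y : G) :
  f @ F --> x -> g @ F --> y -> (fun t => mul (f t) (g t)) @ F --> mul x y.
Proof.
case: tg => _ _ _ mulc _ fx gy.
exact: (cvg_comp _ _ (cvg_pair fx gy) (mulc (x, y))).
Qed.

Lemma cvg_tginv {T : Type} (F : set_system T) {FF : Filter F} (f : T -> G) (x : G) :
  f @ F --> x -> (fun t => inv (f t)) @ F --> inv x.
Proof.
by case: tg => _ _ _ _ invc fx; exact: (cvg_comp _ _ fx (invc x)).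
Qed.

Lemma cvg_tgmulV {T : Type} (F : set_system T) {FF : Filter F} (f g : T -> G) (x : G) :
  f @ F --> x -> g @ F --> x -> (fun t => mul (inv (f t)) (g t)) @ F --> e.
Proof. by move=> fx gx; rewrite -(tgVl x); apply: cvg_tgmul gx; exact: cvg_tginv. Qed.

Lemma closure_tgmul (A B C : set G) x y :
  (forall a b, A a -> B b -> C (mul a b)) ->
  closure A x -> closure B y -> closure C (mul x y).
Proof.
move=> ABC Ax By W Wxy; case: tg => _ _ _ mulc _.
have [[P Q] /= [Px Qy] PQW] := mulc (x, y) _ Wxy.
have [a [Aa Pa]] := Ax _ Px; have [b [Bb Qb]] := By _ Qy.
exists (mul a b); split; first exact: ABC.
exact: (PQW (a, b)).
Qed.

(* A point [z] of [A] close to [x] leaves [z^-1 x y] in the interior of [B]. *)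
Lemma closure_mul_interior (A B C : set G) x y :
  (forall a b, A a -> B b -> C (mul a b)) ->
  closure A x -> nbhs y B -> C (mul x y).
Proof.
move=> ABC Ax By.
have h : (fun z => mul (mul (inv z) x) y) @ x --> y.
  rewrite -[X in _ --> X]tg1l; apply: cvg_tgmul; last exact: cvg_cst.
  by apply: cvg_tgmulV; [exact: cvg_id|exact: cvg_cst].
have [z [Az Bz]] := Ax _ (h _ By).
by have := ABC _ _ Az Bz; rewrite /= -!tgA tgVK.
Qed.

End TopGroup.

Section Lifting.
Variables (R : realType) (G : topologicalType).
Variables (mul : G -> G -> G) (inv : G -> G) (e : G).
Local Notation quad := (R * R * R * R)%type.
Variable p : G -> quad.
Local Notation "x '**' y" := (mul x y) (at level 40, left associativity).

(** The covering property is kept only in its local form at [e]: [p] is injective near [e] and open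
    there relative to determinant 1. Translations carry this to every point. *)
Definition local_cover :=
  [/\ continuous p, forall x y, p (x ** y) = qmul (p x) (p y), p e = qone,
      forall x, qdet (p x) = 1 &
      (exists2 V, nbhs e V & forall x y, V x -> V y -> p x = p y -> x = y) /\
      (forall W, nbhs e W -> \forall M \near (qone : quad),
         qdet M = 1 -> exists2 g, W g & p g = M)].

Hypothesis tg : topological_group mul inv e.
Hypothesis lc : local_cover.

Let pc : continuous p. Proof. by case: lc. Qed.
Let pM x y : p (x ** y) = qmul (p x) (p y). Proof. by case: lc. Qed.
Let p1 : p e = qone. Proof. by case: lc. Qed.
Let pdet x : qdet (p x) = 1. Proof. by case: lc. Qed.

Lemma cover_inv x : p (inv x) = qadj (p x).
Proof.
rewrite -[LHS]qmul1 -(qmul_adj (pdet x)) qmulA -pM (tgVl tg) p1.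
by apply: quad_eq; rewrite /qmul /q11 /q12 /q21 /q22 /=; ring.
Qed.

Lemma cover_ker_discrete : \forall g \near e, p g = qone -> g = e.
Proof.
have [_ _ _ _ [[V Ve injV] _]] := lc.
near=> g => pg; apply: injV; last by rewrite p1.
- by near: g.
- exact: nbhs_singleton.
Unshelve. all: end_near. Qed.

Lemma cover_eq x y : p x = p y -> p (inv x ** y) = qone.
Proof. by move=> h; rewrite pM -h -pM (tgVl tg). Qed.

(* [inv g ** f (q (p g))] tends to [e] and lies in the discrete kernel of [p]. *)
Lemma local_section (X : topologicalType) (f : X -> G) (q : quad -> X)
    (D : set quad) (x0 : X) :
  {for x0, continuous f} -> q M @[M --> p (f x0)] --> x0 ->
  (\forall M \near p (f x0), D M -> p (f (q M)) = M) ->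
  \forall g \near f x0, D (p g) -> f (q (p g)) = g.
Proof.
move=> fc qc pfq.
have h : (fun g => inv g ** f (q (p g))) @ f x0 --> e.
  apply: (cvg_tgmulV tg); first exact: cvg_id.
  apply: (cvg_comp_at f fc).
  by apply: (cvg_comp p q _ qc); exact: pc.
have hk := h _ cover_ker_discrete.
have pfqg := pc pfq.
near=> g => Dg; apply: (tg_eqV tg).
have hg : p (inv g ** f (q (p g))) = qone -> inv g ** f (q (p g)) = e by near: g.
by apply/hg/cover_eq/esym; move: Dg; near: g.
Unshelve. all: end_near. Qed.

Definition lifts (rho : R -> quad) (gam : R -> G) :=
  [/\ continuous gam, gam 0 = e & forall t, p (gam t) = rho t].

(** The quotient [h] of the two curves takes values in the discrete kernel of [p], so it is locally
    constant; the real line is connected. Identities in [G] are proved below by this lemma: check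
    them in matrices and at one parameter value. *)
Lemma lift_unique (f g : R -> G) : continuous f -> continuous g ->
  (forall t, p (f t) = p (g t)) -> f 0 = g 0 -> f = g.
Proof.
move=> fc gc pfg fg0; apply/funext => t.
pose h t := inv (f t) ** g t.
have hloc t0 : \forall t \near t0, h t = h t0.
  have hc : h @ t0 --> h t0.
    by apply: (cvg_tgmul tg); [apply: (cvg_tginv tg); exact: fc|exact: gc].
  have : (fun t => inv (h t0) ** h t) @ t0 --> e.
    by apply: (cvg_tgmulV tg _ hc); exact: cvg_cst.
  move=> /(_ _ cover_ker_discrete) hk; near=> t1.
  apply: (tg_eqV tg); have : p (inv (h t0) ** h t1) = qone -> inv (h t0) ** h t1 = e by near: t1.
  by apply; apply: cover_eq; rewrite !cover_eq.
have hoc A : open [set t | A (h t)].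
  rewrite openE => t0 At0; near=> t1.
  by have /= -> : h t1 = h t0 by near: t1; exact: hloc.
have : [set t | h t = e] = setT.
  have /connected_intervalP : is_interval [set: R] by [].
  apply.
  - by exists 0; rewrite /= /h fg0 (tgVl tg).
  - by exists [set t | h t = e]; rewrite ?setTI//; exact: hoc (fun x => x = e).
  - exists [set t | h t = e]; rewrite ?setTI// -openC.
    exact: hoc (fun x => x <> e).
by move=> /seteqP[_ /(_ t I)] /(tg_eqV tg).
Unshelve. all: end_near. Qed.

(** For fixed [s], the curve [inv (f s) ** f (s + t)] is again a lift of [rho] starting at [e],
    hence equals [f]. *)
Lemma lifts_add rho f : one_param rho -> lifts rho f ->
  forall s t, f (s + t) = f s ** f t.
Proof.
move=> [_ _ _ rhoD] [fc f0 pf] s t.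
suff E : f = (fun t => inv (f s) ** f (s + t)).
  by rewrite [X in _ ** X](congr1 (@^~ t) E) (tgVK tg).
apply: lift_unique => //.
- move=> u; apply: (cvg_tgmul tg); first exact: cvg_cst.
  by apply: (cvg_comp_at f); [exact: fc|apply: cvgD; [exact: cvg_cst|exact: cvg_id]].
- move=> u; rewrite pM !pf rhoD -(pf s) qmulA -pM (tgVl tg).
  by rewrite -pf -pM (tg1l tg).
- by rewrite addr0 (tgVl tg).
Qed.

(* [p] has a continuous local section at the identity along [rho], which is a local
   homomorphism; it extends to all times by [gam t = (sig (t / 2 ^ k)) ^ (2 ^ k)]. *)
Lemma lifts_exist rho : one_param rho -> exists gam, lifts rho gam.
Proof.
move=> [rhoc rho0 rhodet rhoD].
have [_ _ _ _ [[V Ve injV] pO]] := lc.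
(* Products of two points of [V1] stay in [V], where [p] is injective; this is what makes [sig]
   additive. *)
have [V1 V1e V1V] : exists2 V1, nbhs e V1 &
    forall x y, V1 x -> V1 y -> V x /\ V (x ** y).
  have [_ _ _ mulc _] := tg.
  have Vee : nbhs ((e, e).1 ** (e, e).2) V by rewrite (tg1l tg).
  have [[P Q] /= [Pe Qe] PQ] := mulc (e, e) _ Vee.
  exists (P `&` Q `&` V); first by do 2?apply: filterI.
  by move=> x y [[Px _] Vx] [[_ Qy] _]; split=> //; exact: (PQ (x, y)).
have lift_near W : nbhs e W -> \forall t \near 0, exists2 g, W g & p g = rho t.
  move=> We; have := pO _ We; rewrite -rho0 => /rhoc h.
  near=> t; have : qdet (rho t) = 1 -> exists2 g, W g & p g = rho t by near: t.
  exact.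
have [eps eps0 Heps] : exists2 eps : R, 0 < eps &
    forall t, `|t| < eps -> exists2 g, V1 g & p g = rho t.
  have /nbhs_ballP[eps /= eps0 Heps] := lift_near _ V1e.
  by exists eps => // t te; apply: Heps; rewrite /ball /= sub0r normrN.
have [sig sigP] : {sig : R -> G &
    forall t, `|t| < eps -> V1 (sig t) /\ p (sig t) = rho t}.
  apply: (@choice _ _ (fun t g => `|t| < eps -> V1 g /\ p g = rho t)) => t.
  have [te|_] := boolP (`|t| < eps); last by exists e.
  by have [g ? ?] := Heps _ te; exists g.
have sigU t g : `|t| < eps -> V g -> p g = rho t -> g = sig t.
  move=> te Vg pg; have [/V1V V1t pt] := sigP _ te.
  by apply: injV => //; [case: (V1t (sig t)) => //; case: (sigP _ te)|rewrite pg pt].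
have sigD s t : `|s| < eps -> `|t| < eps -> `|s + t| < eps -> sig (s + t) = sig s ** sig t.
  move=> se te ste; have [Vs ps] := sigP _ se; have [Vt pt] := sigP _ te.
  by apply/esym/sigU => //; [case: (V1V _ _ Vs Vt)|rewrite pM ps pt rhoD].
have eps_gt0 : `|0 : R| < eps by rewrite normr0.
have sig0 : sig 0 = e.
  by apply/esym/sigU => //; [exact: nbhs_singleton|rewrite p1 rho0].
have sigc0 : sig @ 0 --> e.
  move=> W We; have := lift_near _ (filterI We Ve) => h.
  have h1 : \forall t \near (0 : R), `|t| < eps.
    exact: near_norm_lt.
  change (\forall t \near (0 : R), W (sig t)).
  near=> t; have te : `|t| < eps by near: t.
  have [g [Wg Vg] pg] : exists2 g, (W `&` V) g & p g = rho t.
    by near: t; exact: h.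
  by rewrite -(sigU _ _ te Vg pg).
have sigc t0 : `|t0| < eps -> sig @ t0 --> sig t0.
  move=> t0e.
  have h : (fun t => sig t0 ** sig (t - t0)) @ t0 --> sig t0.
    rewrite -[X in _ --> X](tg1r tg); apply: (cvg_tgmul tg); first exact: cvg_cst.
    have t00 : (fun t => t - t0) @ t0 --> (0 : R).
      by rewrite -[X in _ --> X](subrr t0); apply: cvgB; [exact: cvg_id|exact: cvg_cst].
    exact: (cvg_comp _ _ t00 sigc0).
  apply: cvg_trans h; apply: near_eq_cvg.
  have h1 : \forall t \near t0, `|t| < eps.
    exact: near_norm_lt.
  have h2 : \forall t \near t0, `|t - t0| < eps.
    exact: near_dist_lt.
  near=> t; have te : `|t| < eps by near: t.
  have tte : `|t - t0| < eps by near: t.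
  by rewrite -sigD ?subrKC.
(* Doubling undoes halving of the argument while that argument stays in the domain of [sig], so
   every sufficiently large number of doublings gives the same value ([gamE]). *)
pose dbl g := g ** g.
have dblc k (h : R -> G) (t0 : R) : h @ t0 --> h t0 ->
    (fun t => iter k dbl (h t)) @ t0 --> iter k dbl (h t0).
  by move=> hc; elim: k => [//|k IH] /=; exact: (cvg_tgmul tg).
have step k t : `|t| < eps * 2 ^+ k ->
    iter k.+1 dbl (sig (t / 2 ^+ k.+1)) = iter k dbl (sig (t / 2 ^+ k)).
  move=> te; rewrite iterSr; congr (iter k dbl _).
  have te1 : `|t / 2 ^+ k| < eps.
    by rewrite normrM normfV (ger0_norm (exprn_ge0 _ _))// ltr_pdivrMr// exprn_gt0.
  have half : t / 2 ^+ k = t / 2 ^+ k.+1 + t / 2 ^+ k.+1.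
    by rewrite exprS; field; rewrite expf_neq0.
  have te2 : `|t / 2 ^+ k.+1| < eps.
    have : `|t / 2 ^+ k.+1| = `|t / 2 ^+ k| / 2.
      by rewrite exprSr invfM mulrA normrM (ger0_norm (_ : 0 <= 2^-1)).
    by move: te1; have := normr_ge0 (t / 2 ^+ k); lra.
  by rewrite /dbl -sigD// -half.
have steps k j t : `|t| < eps * 2 ^+ k ->
    iter (k + j) dbl (sig (t / 2 ^+ (k + j))) = iter k dbl (sig (t / 2 ^+ k)).
  move=> te; elim: j => [|j IH]; first by rewrite addn0.
  rewrite addnS step ?IH//; apply: lt_le_trans te _.
  by rewrite ler_pM2l// ler_eXn2l ?leq_addr// ltr1n.
have [N NP] : {N : R -> nat & forall t, `|t| < eps * 2 ^+ N t}.
  apply: (@choice _ _ (fun t k => `|t| < eps * 2 ^+ k)) => t.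
  exists (Num.bound (`|t| / eps)).
  rewrite mulrC -ltr_pdivrMr//.
  apply: lt_trans (archi_boundP _) _; first by rewrite divr_ge0// ltW.
  by rewrite -natrX ltr_nat ltn_expl.
pose gam t := iter (N t) dbl (sig (t / 2 ^+ N t)).
have gamE k t : `|t| < eps * 2 ^+ k -> gam t = iter k dbl (sig (t / 2 ^+ k)).
  move=> te; rewrite /gam; have [kN|Nk] := leqP k (N t).
    by rewrite -(subnKC kN) steps.
  by rewrite -(subnKC (ltnW Nk)) steps.
exists gam; split.
(* Near [t0] one fixed number [k] of doublings serves all times, so continuity follows from that of
   [sig]. *)
- move=> t0; have te0 := NP t0; set k := N t0 in te0.
  have h : (fun t => iter k dbl (sig (t / 2 ^+ k))) @ t0 --> gam t0.
    rewrite (gamE k)//; apply: (dblc k (fun t => sig (t / 2 ^+ k))).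
    apply: (cvg_comp (fun t => t / 2 ^+ k) sig); last first.
      apply: sigc.
      by rewrite normrM normfV (ger0_norm (exprn_ge0 _ _))// ltr_pdivrMr// exprn_gt0.
    by apply: cvgM; [exact: cvg_id|exact: cvg_cst].
  apply: cvg_trans h; apply: near_eq_cvg.
  have h1 : \forall t \near t0, `|t| < eps * 2 ^+ k.
    exact: near_norm_lt.
  by near=> t; rewrite (gamE k)//; near: t.
- by rewrite (gamE 0%N) ?expr0 ?mulr1// mul0r.
- move=> t.
  have iterP k g s : p g = rho s -> p (iter k dbl g) = rho (s *+ 2 ^ k).
    elim: k g s => [|k IH] g s pg //; rewrite iterSr expnS mulrnA.
    by apply: IH; rewrite pM pg mulr2n rhoD.
  rewrite /gam (iterP _ _ (t / 2 ^+ N t)).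
    by congr rho; rewrite -[LHS]mulr_natr natrX divfK// expf_neq0.
  have te : `|t / 2 ^+ N t| < eps.
    by rewrite normrM normfV (ger0_norm (exprn_ge0 _ _))// ltr_pdivrMr// exprn_gt0.
  by case: (sigP _ te).
Unshelve. all: end_near. Qed.

End Lifting.

(** * Points reachable in small time *)

Lemma closure_idem_subset (T : topologicalType) (A : set T) : closure (closure A) `<=` closure A.
Proof.
by move=> x Ax B /nbhs_interior/Ax[y [Ay By]]; exact: Ay.
Qed.

Section RealFacts.
Variable R : realType.

Lemma cos_atan_gt0 (s : R) : 0 < cos (atan s).
Proof. by apply: cos_gt0_pihalf; rewrite atan_gtNpi2 atan_ltpi2. Qed.

Lemma sin_atan (s : R) : sin (atan s) = s * cos (atan s).
Proof.
by rewrite -{2}(atanK s) /tan divfK// gt_eqF// cos_atan_gt0.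
Qed.

Lemma cos_atan_sqr (s : R) : cos (atan s) ^+ 2 * (1 + s ^+ 2) = 1.
Proof. by rewrite -[RHS](cos2Dsin2 (atan s)) sin_atan; ring. Qed.

(** This inverts [s |-> cos (atan s)], that is [(1 + s^2)^(-1/2)], on positive [s]; [RT_interior]
    uses it to read a parameter off a matrix entry. *)
Lemma cos_atan_sqrt (x : R) : 0 < x < 1 -> cos (atan (Num.sqrt (x ^- 2 - 1))) = x.
Proof.
move=> /andP[x0 x1].
have h : 0 <= x ^- 2 - 1 by rewrite subr_ge0 invf_ge1 ?exprn_gt0// expr_le1// ltW.
rewrite cos_atan sqr_sqrtr// addrCA subrr addr0 sqrtrV ?exprn_ge0 ?ltW//.
by rewrite sqrtr_sqr ger0_norm ?ltW// invrK.
Qed.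

Lemma cos_atan_lt1 (s : R) : 0 < s -> cos (atan s) < 1.
Proof.
move=> s0; have := cos_atan_sqr s; have := cos_atan_gt0 s; set c := cos _ => c0 h.
rewrite ltNge; apply/negP => c1.
have : 1 <= c ^+ 2 by rewrite expr_ge1// ltW.
have : 0 < s ^+ 2 by rewrite exprn_gt0.
nra.
Qed.

Lemma continuous_lncos_atan : continuous (fun s : R => - ln (cos (atan s))).
Proof.
move=> s; apply: cvgN; apply: (cvg_comp_at (@ln R)); first exact/continuous_ln/cos_atan_gt0.
by apply: (cvg_comp_at (@cos R)); [exact: continuous_cos|exact: continuous_atan].
Qed.

Lemma lncos_atan0 : - ln (cos (atan 0)) = 0 :> R.
Proof. by rewrite atan0 cos0 ln1 oppr0. Qed.

Lemma continuous_lnch : continuous (fun s : R => - ln (ch s)).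
Proof.
move=> s; apply: cvgN; apply: (cvg_comp_at (@ln R)); first exact/continuous_ln/ch_gt0.
exact: ch_continuous.
Qed.

Lemma expR_lnK (x : R) : 0 < x -> expR (ln x) = x.
Proof. by move=> x0; rewrite lnK. Qed.

Lemma expRN_lnK (x : R) : 0 < x -> expR (- ln x) = x^-1.
Proof. by move=> x0; rewrite expRN expR_lnK. Qed.

Lemma atan_ge0 (s : R) : 0 <= s -> 0 <= atan s.
Proof. by move=> s0; rewrite -(@atan0 R); exact: le_atan. Qed.

(** Gram-Schmidt on the columns [(a, c)] and [(b, d)]: the first minus its projection on the second
    is orthogonal to [(b, d)], and determinant 1 fixes its length. *)
Lemma iwasawa_identity (a b c d E : R) : E != 0 -> E * E = b ^+ 2 + d ^+ 2 ->
  a * d - b * c = 1 ->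
  a * E - b * (E * ((a * b + c * d) / (b ^+ 2 + d ^+ 2))) = d / E /\
  c * E - d * (E * ((a * b + c * d) / (b ^+ 2 + d ^+ 2))) = - (b / E).
Proof.
move=> E0 EE det1; rewrite -EE; split; apply: (mulIf E0); rewrite ?mulNr divfK//.
- have -> : (a * E - b * (E * ((a * b + c * d) / (E * E)))) * E =
      a * (E * E) - b * (a * b + c * d) by field.
  by rewrite EE -[RHS]mulr1 -det1; ring.
- have -> : (c * E - d * (E * ((a * b + c * d) / (E * E)))) * E =
      c * (E * E) - d * (a * b + c * d) by field.
  by rewrite EE -[RHS]mulr1 -det1; ring.
Qed.

End RealFacts.

Section Reach.
Variables (R : realType) (G : topologicalType).
Variables (mul : G -> G -> G) (inv : G -> G) (e : G).
Variable p : G -> R * R * R * R.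
Local Notation "x '**' y" := (mul x y) (at level 40, left associativity).
Hypothesis tg : topological_group mul inv e.
Hypothesis lc : local_cover mul e p.
Variables gA gB gC gK : R -> G.
Hypothesis lA : lifts e p (@upperm R) gA.
Hypothesis lB : lifts e p (@lowerm R) gB.
Hypothesis lC : lifts e p (@diagm R) gC.
Hypothesis lK : lifts e p (@rotm R) gK.

Let pM x y : p (x ** y) = qmul (p x) (p y). Proof. by case: lc. Qed.
Let gAc : continuous gA. Proof. by case: lA. Qed.
Let gBc : continuous gB. Proof. by case: lB. Qed.
Let gCc : continuous gC. Proof. by case: lC. Qed.
Let gKc : continuous gK. Proof. by case: lK. Qed.
Let gA0 : gA 0 = e. Proof. by case: lA. Qed.
Let gB0 : gB 0 = e. Proof. by case: lB. Qed.
Let gC0 : gC 0 = e. Proof. by case: lC. Qed.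
Let gK0 : gK 0 = e. Proof. by case: lK. Qed.
Let pA t : p (gA t) = upperm t. Proof. by case: lA. Qed.
Let pB t : p (gB t) = lowerm t. Proof. by case: lB. Qed.
Let pC t : p (gC t) = diagm t. Proof. by case: lC. Qed.
Let pK t : p (gK t) = rotm t. Proof. by case: lK. Qed.
Let gAD s t : gA (s + t) = gA s ** gA t.
Proof. exact: (lifts_add tg lc (@one_param_upperm R) lA). Qed.
Let gCD s t : gC (s + t) = gC s ** gC t.
Proof. exact: (lifts_add tg lc (@one_param_diagm R) lC). Qed.
Let gKD s t : gK (s + t) = gK s ** gK t.
Proof. exact: (lifts_add tg lc (@one_param_rotm R) lK). Qed.

(** * Gauss factorization of the lifted one-parameter subgroups *)

Definition gauss l k r := gB l ** gC k ** gA r.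

Lemma cover_gauss l k r : p (gauss l k r) =
  (expR (- k), expR (- k) * r, l * expR (- k), l * expR (- k) * r + expR k).
Proof.
rewrite /gauss !pM pB pC pA.
by apply: quad_eq; rewrite /qmul /lowerm /diagm /upperm /q11 /q12 /q21 /q22 /=; ring.
Qed.

Lemma cvg_gauss {T : Type} (F : set_system T) {FF : Filter F} (f g h : T -> R) (l k r : R) :
  f @ F --> l -> g @ F --> k -> h @ F --> r ->
  (fun t => gauss (f t) (g t) (h t)) @ F --> gauss l k r.
Proof.
move=> fl gk hr; apply: (cvg_tgmul tg); last exact: (cvg_comp_at gA (@gAc _)).
by apply: (cvg_tgmul tg); [exact: (cvg_comp_at gB (@gBc _))|exact: (cvg_comp_at gC (@gCc _))].
Qed.

Lemma gauss00 l : gauss l 0 0 = gB l.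
Proof. by rewrite /gauss gC0 gA0 !(tg1r tg). Qed.

(** The factorization exists where the cosine is positive. Taking the tangent [s] of the angle as
    parameter makes both sides curves on the whole real line, to which [lift_unique] applies. *)
Lemma ell_gauss w gam s : w != 0 -> lifts e p (ellm w) gam ->
  gam (atan s) = gauss (- (w * s)) (- ln (cos (atan s))) (s / w).
Proof.
move=> w0 [gc g0 pg].
suff E : (fun s => gam (atan s)) =
    (fun s => gauss (- (w * s)) (- ln (cos (atan s))) (s / w)) by exact: (congr1 (@^~ s) E).
apply: (lift_unique tg lc).
- by move=> t; apply: (cvg_comp_at gam); [exact: gc|exact: continuous_atan].
- move=> t; apply: cvg_gauss.
  + by apply: cvgN; apply: cvgM; [exact: cvg_cst|exact: cvg_id].
  + exact: continuous_lncos_atan.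
  + by apply: cvgM; [exact: cvg_id|exact: cvg_cst].
- move=> t; have c0 := cos_atan_gt0 t; have h := cos_atan_sqr t.
  rewrite pg cover_gauss opprK expRN_lnK// expR_lnK//.
  apply: quad_eq; rewrite /ellm /q11 /q12 /q21 /q22 /= ?sin_atan; move: c0 h;
    set c := cos _ => c0 h; have cn0 : c != 0 by rewrite gt_eqF.
  + by [].
  + by field.
  + by field.
  + by apply: (mulfI cn0); rewrite mulrDr mulfV// -h; field.
- by rewrite atan0 g0 mulr0 oppr0 mul0r cos0 ln1 oppr0 gauss00 gB0.
Qed.

(** Since [ch] never vanishes, the hyperbolic subgroup admits Gauss factors for all times and no
    change of parameter is called for. *)
Lemma hyp_gauss w gam s : w != 0 -> lifts e p (hypm w) gam ->
  gam s = gauss (w * (sh s / ch s)) (- ln (ch s)) (sh s / ch s / w).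
Proof.
move=> w0 [gc g0 pg].
suff E : gam = (fun s => gauss (w * (sh s / ch s)) (- ln (ch s)) (sh s / ch s / w)).
  exact: (congr1 (@^~ s) E).
have thc t : (fun s => sh s / ch s) @ t --> sh t / ch t.
  apply: cvgM; first exact: sh_continuous.
  by apply: cvgV; [rewrite gt_eqF// ch_gt0|exact: ch_continuous].
apply: (lift_unique tg lc) => //.
- move=> t; apply: cvg_gauss.
  + by apply: cvgM; [exact: cvg_cst|exact: thc].
  + exact: continuous_lnch.
  + by apply: cvgM; [exact: thc|exact: cvg_cst].
- move=> t; have c0 := ch_gt0 t; have h := ch2Bsh2 t.
  rewrite pg cover_gauss opprK expRN_lnK// expR_lnK//.
  have cn0 : ch t != 0 by rewrite gt_eqF.
  apply: quad_eq; rewrite /hypm /q11 /q12 /q21 /q22 /=.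
  + by [].
  + by field; rewrite w0 cn0.
  + by field.
  + apply: (mulfI cn0); rewrite mulrDr mulfV// -h; field; by rewrite cn0 w0.
- by rewrite g0 sh0 ch0 ln1 !mul0r mulr0 oppr0 gauss00 gB0.
Qed.

(* [RT T] is the set of points reachable in time at most [T].  The durations [t / w]
   come from [t (w^-1 a -+ w b) = (t / w) (a -+ w^2 b)]. *)
Definition reach_system (RT : R -> set G) :=
  [/\ RT 0 e, (forall T T' g, T <= T' -> RT T g -> RT T' g),
      (forall T T' x y, RT T x -> RT T' y -> RT (T + T') (x ** y)) &
  [/\ (forall t, 0 <= t -> RT t (gA t)),
      (forall w t gam, 0 < w -> 0 <= t -> lifts e p (ellm w) gam -> RT (t / w) (gam t)) &
      (forall w t gam, 0 < w -> 0 <= t -> lifts e p (hypm w) gam -> RT (t / w) (gam t))]].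

Variable RT : R -> set G.
Hypothesis rs : reach_system RT.

Let RT0 : RT 0 e. Proof. by case: rs. Qed.
Let RTle T T' g : T <= T' -> RT T g -> RT T' g. Proof. by case: rs => _ h _ _; exact: h. Qed.
Let RTM T T' x y : RT T x -> RT T' y -> RT (T + T') (x ** y).
Proof. by case: rs => _ _ h _; exact: h. Qed.
Let RTA t : 0 <= t -> RT t (gA t). Proof. by case: rs => _ _ _ [h _ _]; exact: h. Qed.

(** This is the semigroup E of the outline. *)
Definition st_limit : set G := [set g | forall T, 0 < T -> closure (RT T) g].
Definition st_reach : set G := [set g | forall T, 0 < T -> RT T g].

Lemma st_reach_limit : st_reach `<=` st_limit.
Proof. by move=> g gr T T0; apply: subset_closure; exact: gr. Qed.

Lemma st_limit_e : st_limit e.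
Proof. by apply: st_reach_limit => T T0; apply: RTle RT0; exact: ltW. Qed.

Lemma closure_RTM T T' x y :
  closure (RT T) x -> closure (RT T') y -> closure (RT (T + T')) (x ** y).
Proof. by apply: (closure_tgmul tg) => u v; exact: RTM. Qed.

Lemma st_limitM x y : st_limit x -> st_limit y -> st_limit (x ** y).
Proof.
move=> xl yl T T0; rewrite (splitr T); have T20 : 0 < T / 2 by rewrite divr_gt0.
by apply: closure_RTM; [exact: xl|exact: yl].
Qed.

(* The control is chosen so that the first Gauss factor is exactly [gB v]; the two
   others then tend to [e] with the duration. *)
Lemma st_limit_lower v : st_limit (gB v).
Proof.
(* Large positive controls (hyperbolic pieces) produce positive [v], large negative ones (elliptic
   pieces) negative [v]. *)
have [v0|v0|->] := ltrgt0P v; last by rewrite gB0; exact: st_limit_e.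
- move=> T T0; pose th s := @sh R s / ch s.
  have thc : th @ (0 : R) --> th 0.
    apply: cvgM; first exact: sh_continuous.
    by apply: cvgV; [rewrite gt_eqF// ch_gt0|exact: ch_continuous].
  have th00 : th 0 = 0 by rewrite /th sh0 mul0r.
  have timec : (fun s => s * th s / v) @ (0 : R) --> 0 * th 0 / v.
    by apply: cvgM; [apply: cvgM; [exact: cvg_id|exact: thc]|exact: cvg_cst].
  rewrite !mul0r in timec.
  have fc : (fun s => gauss v (- ln (ch s)) (th s * th s / v)) @ (0 : R) -->
      gauss v (- ln (ch 0)) (th 0 * th 0 / v).
    apply: cvg_gauss; [exact: cvg_cst|exact: continuous_lnch|].
    by apply: cvgM; [apply: cvgM; exact: thc|exact: cvg_cst].
  rewrite ch0 ln1 oppr0 th00 !mul0r gauss00 in fc.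
  apply: (closure_cvg_near (cvg_at_right_filter fc)).
  have near_time : \forall s \near 0^'+, s * th s / v < T.
    exact: (cvgr_lt _ (cvg_at_right_filter timec)).
  near=> s; have s0 : 0 < s by near: s; exact: nbhs_right_gt.
  have sh_s : 0 < sh s.
    by rewrite /sh divr_gt0// subr_gt0 ltr_expR; lra.
  have th0 : 0 < th s by rewrite divr_gt0// ch_gt0.
  (* Then [w * th s = v], and the duration [s / w] is [s * th s / v], which tends to 0 with [s]. *)
  pose w := v / th s; have w0 : 0 < w by rewrite divr_gt0.
  have [gam lgam] := lifts_exist tg lc (one_param_hypm (lt0r_neq0 w0)).
  have -> : gauss v (- ln (ch s)) (th s * th s / v) = gam s.
    rewrite (hyp_gauss _ (lt0r_neq0 w0) lgam) -/(th s) /w divfK ?gt_eqF//.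
    by congr gauss; field; rewrite !gt_eqF.
  case: rs => _ _ _ [_ _ /(_ w s gam w0 (ltW s0) lgam)]; apply: RTle.
  rewrite /w invf_div mulrA; apply: ltW; by near: s.
- move=> T T0.
  have timec : (fun s => atan s * s / - v) @ (0 : R) --> atan 0 * 0 / - v.
    apply: cvgM; last exact: cvg_cst.
    by apply: cvgM; [exact: continuous_atan|exact: cvg_id].
  rewrite mulr0 mul0r in timec.
  have fc : (fun s => gauss v (- ln (cos (atan s))) (s * s / - v)) @ (0 : R) -->
      gauss v (- ln (cos (atan 0))) (0 * 0 / - v).
    apply: cvg_gauss; [exact: cvg_cst|exact: continuous_lncos_atan|].
    by apply: cvgM; [apply: cvgM; exact: cvg_id|exact: cvg_cst].
  rewrite lncos_atan0 !mul0r gauss00 in fc.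
  apply: (closure_cvg_near (cvg_at_right_filter fc)).
  have near_time : \forall s \near 0^'+, atan s * s / - v < T.
    exact: (cvgr_lt _ (cvg_at_right_filter timec)).
  near=> s; have s0 : 0 < s by near: s; exact: nbhs_right_gt.
  (* Here [- (w * s) = v], and the duration [atan s / w] tends to 0. *)
  pose w := - v / s; have w0 : 0 < w by rewrite divr_gt0// oppr_gt0.
  have [gam lgam] := lifts_exist tg lc (one_param_ellm (lt0r_neq0 w0)).
  have -> : gauss v (- ln (cos (atan s))) (s * s / - v) = gam (atan s).
    rewrite (ell_gauss _ (lt0r_neq0 w0) lgam) /w divfK ?gt_eqF// opprK.
    by congr gauss; field; rewrite gt_eqF// lt_eqF.
  case: rs => _ _ _ [_ /(_ w (atan s) gam w0 (atan_ge0 (ltW s0)) lgam) + _]; apply: RTle.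
  rewrite /w invf_div mulrA; apply: ltW; by near: s.
Unshelve. all: end_near. Qed.

(** Both sides are curves in [k] with the same projection, and both equal [gA t] at [k = 0]. *)
Lemma lower_upper_lower k t : t != 0 ->
  gB ((expR k - 1) / t) ** gA t ** gB ((expR (- k) - 1) / t) = gC k ** gA (t * expR k).
Proof.
move=> t0.
suff E : (fun k => gB ((expR k - 1) / t) ** gA t ** gB ((expR (- k) - 1) / t)) =
    (fun k => gC k ** gA (t * expR k)) by exact: (congr1 (@^~ k) E).
apply: (lift_unique tg lc).
- move=> x; apply: (cvg_tgmul tg); [apply: (cvg_tgmul tg); last exact: cvg_cst|].
    apply: (cvg_comp_at gB (@gBc _)); apply: cvgM; last exact: cvg_cst.
    by apply: cvgB; [exact: continuous_expR|exact: cvg_cst].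
  apply: (cvg_comp_at gB (@gBc _)); apply: cvgM; last exact: cvg_cst.
  by apply: cvgB; [exact: expRN_continuous|exact: cvg_cst].
- move=> x; apply: (cvg_tgmul tg); first exact: gCc.
  apply: (cvg_comp_at gA (@gAc _)); apply: cvgM; first exact: cvg_cst.
  exact: continuous_expR.
- move=> x; rewrite !pM !pB !pA pC; have Ex0 : expR x != 0 by rewrite gt_eqF// expR_gt0.
  apply: quad_eq; rewrite /qmul /lowerm /diagm /upperm /q11 /q12 /q21 /q22 /= ?expRN;
    by field; rewrite ?t0 ?Ex0.
- by rewrite oppr0 expR0 subrr mul0r gB0 gC0 mulr1 !(tg1l tg) (tg1r tg).
Qed.

Lemma st_limit_diag k : st_limit (gC k).
Proof.
(* Each approximating point is itself only in the closure of [RT T]: its two lower factors are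
   limits, and only its middle factor takes time, namely [t]. *)
move=> T T0; apply: closure_idem_subset.
have fc : (fun t => gC k ** gA (t * expR k)) @ (0 : R) --> gC k ** gA (0 * expR k).
  apply: (cvg_tgmul tg); first exact: cvg_cst.
  by apply: (cvg_comp_at gA (@gAc _)); apply: cvgM; [exact: cvg_id|exact: cvg_cst].
rewrite mul0r gA0 (tg1r tg) in fc.
apply: (closure_cvg_near (cvg_at_right_filter fc)).
near=> t; have t0 : 0 < t by near: t; exact: nbhs_right_gt.
have tT : t < T / 3 by near: t; apply: nbhs_right_lt; rewrite divr_gt0.
rewrite -lower_upper_lower ?gt_eqF//.
have -> : T = T / 3 + T / 3 + T / 3 by field.
have T30 : 0 < T / 3 by rewrite divr_gt0.
apply: closure_RTM; [apply: closure_RTM|]; [exact: st_limit_lower| |exact: st_limit_lower].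
by apply: subset_closure; apply: RTle (RTA (ltW t0)); exact: ltW.
Unshelve. all: end_near. Qed.

Lemma diag_conj_upper k t : gC k ** gA t ** gC (- k) = gA (t * expR (- k) ^+ 2).
Proof.
suff E : (fun t => gC k ** gA t ** gC (- k)) = (fun t => gA (t * expR (- k) ^+ 2)).
  exact: (congr1 (@^~ t) E).
apply: (lift_unique tg lc).
- move=> x; apply: (cvg_tgmul tg); last exact: cvg_cst.
  by apply: (cvg_tgmul tg); [exact: cvg_cst|exact: gAc].
- move=> x; apply: (cvg_comp_at gA (@gAc _)).
  by apply: cvgM; [exact: cvg_id|exact: cvg_cst].
- move=> x; rewrite !pM !pC !pA; have Ek0 : expR k != 0 by rewrite gt_eqF// expR_gt0.
  by apply: quad_eq; rewrite /qmul /diagm /upperm /q11 /q12 /q21 /q22 /= ?opprK ?expRN; field.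
- by rewrite gA0 (tg1r tg) -gCD subrr gC0 mul0r gA0.
Qed.

Lemma st_limit_upper s : 0 <= s -> st_limit (gA s).
Proof.
rewrite le_eqVlt => /predU1P[<-|s0 T T0]; first by rewrite gA0; exact: st_limit_e.
have T30 : 0 < T / 3 by rewrite divr_gt0.
(* With this [k], conjugation by [gC k] stretches the piece [gA (T / 3)] to [gA s], however large
   [s] is. *)
pose k := ln (T / 3 / s) / 2; have Ts0 : 0 < T / 3 / s by rewrite divr_gt0.
have -> : s = T / 3 * expR (- k) ^+ 2.
  rewrite expr2 -expRD -opprD /k -splitr expRN_lnK//.
  by field; rewrite !gt_eqF.
rewrite -diag_conj_upper.
have -> : T = T / 3 + T / 3 + T / 3 by field.
apply: closure_RTM; [apply: closure_RTM|]; [exact: st_limit_diag| |exact: st_limit_diag].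
have -> : (T / 3 + T / 3 + T / 3) / 3 = T / 3 by field.
by apply: subset_closure; apply: RTA; exact: ltW.
Qed.

Lemma st_limit_gauss l k r : 0 <= r -> st_limit (gauss l k r).
Proof.
move=> r0; apply: st_limitM; last exact: st_limit_upper.
by apply: st_limitM; [exact: st_limit_lower|exact: st_limit_diag].
Qed.

(** For an angle [x] in [[0, pi / 2[] the upper Gauss factor has parameter [tan x >= 0], so
    [st_limit_gauss] applies; a larger angle is a multiple of such an angle. *)
Lemma st_limit_rot t : 0 <= t -> st_limit (gK t).
Proof.
move=> t0; have small x : 0 <= x < pi / 2 -> st_limit (gK x).
  move=> /andP[x0 x1].
  have xI : - (pi / 2) < x < pi / 2 by rewrite x1 andbT (lt_le_trans _ x0)// oppr_lt0 divr_gt0// pi_gt0.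
  have -> : x = atan (tan x) by rewrite tanK// in_itv.
  have lK1 : lifts e p (ellm 1) gK by rewrite -rotmE.
  rewrite (ell_gauss _ (oner_neq0 _) lK1).
  apply: st_limit_gauss; rewrite divr1 divr_ge0//; last by rewrite ltW// cos_gt0_pihalf.
  by apply: sin_ge0_pi; rewrite x0/= (le_trans (ltW x1))// ler_pdivrMr// ler_peMr ?pi_ge0// ler1n.
have mult n x : st_limit (gK x) -> st_limit (gK (x *+ n)).
  move=> xl; elim: n => [|n IH]; first by rewrite mulr0n gK0; exact: st_limit_e.
  by rewrite mulrS gKD; exact: st_limitM.
pose n := (Num.bound t).+1.
have n0 : 0 < n%:R :> R by rewrite ltr0n.
have -> : t = (t / n%:R) *+ n by rewrite -[RHS]mulr_natr divfK// gt_eqF.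
apply/mult/small; rewrite divr_ge0//=.
apply: lt_le_trans (pihalf_ge1 R); rewrite ltr_pdivrMr// mul1r.
by apply: lt_trans (archi_boundP t0) _; rewrite ltr_nat.
Qed.

(** An elliptic piece with lower factor [l] and angle [atan s] has upper factor [- s * s / l]; a
    final piece of [gA] supplies the missing [r + s * s / l]. *)
Lemma RT_gauss l s r : l < 0 -> 0 < s -> 0 <= r + s * s / l ->
  RT (atan s * s / - l + (r + s * s / l)) (gauss l (- ln (cos (atan s))) r).
Proof.
move=> l0 s0 rs0; pose w := - l / s.
have w0 : 0 < w by rewrite divr_gt0// oppr_gt0.
have [gam lgam] := lifts_exist tg lc (one_param_ellm (lt0r_neq0 w0)).
have -> : gauss l (- ln (cos (atan s))) r = gam (atan s) ** gA (r + s * s / l).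
  rewrite (ell_gauss _ (lt0r_neq0 w0) lgam) /gauss -[RHS](tgA tg) -gAD.
  have sn0 : s != 0 by rewrite gt_eqF.
  have ln0 : l != 0 by rewrite lt_eqF.
  by congr (gB _ ** _ ** gA _); rewrite /w; field; rewrite ?oppr_eq0 ?ln0 ?sn0.
apply: RTM (RTA rs0).
case: rs => _ _ _ [_ /(_ w (atan s) gam w0 (atan_ge0 (ltW s0)) lgam) + _].
by rewrite /w invf_div mulrA.
Qed.

(* The points [y x] below are an elliptic piece of control [- x ^- 2] followed by
   the piece [gA x]; nearby points are obtained by moving the three parameters. *)
Lemma RT_interior T W : 0 < T -> nbhs e W -> exists2 y, W y & nbhs y (RT T).
Proof.
move=> T0 We.
pose f (x : R * R * R) := gauss x.1.1 (- ln (cos (atan x.1.2))) x.2.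
have fE l s r : f (l, s, r) = gauss l (- ln (cos (atan s))) r by [].
have fc : continuous f.
  move=> x; apply: cvg_gauss; [exact: (cvg_comp _ _ cvg_fst cvg_fst)| |exact: cvg_snd].
  apply: (cvg_comp_at _ (@continuous_lncos_atan R _)).
  exact: (cvg_comp _ _ cvg_fst cvg_snd).
(* With [l = - x] and [s = x * x], the term [s * s / l] is [- x ^+ 3], so the final [gA] piece lasts
   exactly [x] and the total duration is [atan (x * x) * x + x]. *)
pose y x := f (- x, x * x, x * x * x + x).
have yc : y @ (0 : R) --> f (- 0, 0 * 0, 0 * 0 * 0 + 0).
  apply: cvg_gauss; first by apply: cvgN; exact: cvg_id.
    apply: (cvg_comp_at _ (@continuous_lncos_atan R _)).
    by apply: cvgM; exact: cvg_id.
  apply: cvgD; last exact: cvg_id.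
  by apply: cvgM; [apply: cvgM|]; exact: cvg_id.
rewrite oppr0 !mul0r addr0 fE lncos_atan0 gauss00 gB0 in yc.
have timec : (fun x => atan (x * x) * x + x) @ (0 : R) --> atan (0 * 0) * 0 + 0.
  apply: cvgD; last exact: cvg_id.
  apply: cvgM; last exact: cvg_id.
  apply: (cvg_comp_at _ (@continuous_atan R _)).
  by apply: cvgM; exact: cvg_id.
rewrite mulr0 addr0 in timec.
have nW : \forall x \near 0^'+, W (y x) by exact: (cvg_at_right_filter yc).
have nT : \forall x \near 0^'+, atan (x * x) * x + x < T.
  exact: (cvgr_lt _ (cvg_at_right_filter timec)).
have nP : \forall x \near 0^'+, 0 < x :> R by exact: nbhs_right_gt.
have /filter_ex[x [[Wx Tx] x0]] : \forall x \near 0^'+, (W (y x) /\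
    atan (x * x) * x + x < T) /\ 0 < x.
  by apply: filterI => //; apply: filterI.
exists (y x) => //.
have xx0 : 0 < x * x by rewrite mulr_gt0.
pose x0' := (- x, x * x, x * x * x + x).
(* The parameters are recovered from three entries, the fourth being fixed by the determinant. The
   square root requires [0 < q11 M < 1], whence [D]. *)
pose q (M : R * R * R * R) := (q21 M / q11 M, Num.sqrt (q11 M ^- 2 - 1), q12 M / q11 M).
have pf u : p (f u) = (cos (atan u.1.2), cos (atan u.1.2) * u.2, u.1.1 * cos (atan u.1.2),
    u.1.1 * cos (atan u.1.2) * u.2 + (cos (atan u.1.2))^-1).
  by rewrite cover_gauss opprK expRN_lnK ?expR_lnK// cos_atan_gt0.
have c1 := cos_atan_lt1 xx0; have c0 := cos_atan_gt0 (x * x).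
have qf : q (p (f x0')) = x0'.
  have cn0 : cos (atan (x * x)) != 0 by rewrite gt_eqF.
  rewrite pf /q /q11 /q12 /q21 /=; congr (_, _, _).
  - by field.
  - have -> : cos (atan (x * x)) ^- 2 - 1 = (x * x) ^+ 2.
      apply: (mulfI (expf_neq0 2 cn0)); rewrite mulrBr mulfV ?expf_neq0//.
      by rewrite -[X in X - _](cos_atan_sqr (x * x)); ring.
    by rewrite sqrtr_sqr ger0_norm// ltW.
  - by field.
have q11c : q11 M @[M --> p (f x0')] --> cos (atan (x * x)).
  have -> : cos (atan (x * x)) = q11 (p (f x0')) by rewrite pf.
  exact: q11_continuous.
have qc : q M @[M --> p (f x0')] --> x0'.
  rewrite -[X in _ --> X]qf.
  have n0 : q11 (p (f x0')) != 0 by rewrite pf /q11/= gt_eqF.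
  apply: triple_cvg.
  - by apply: cvgM; [exact: q21_continuous|apply: cvgV => //; exact: q11_continuous].
  - apply: (cvg_comp_at _ (@sqrt_continuous R _)).
    apply: cvgB; last exact: cvg_cst.
    apply: cvgV; first by rewrite expf_neq0.
    by apply: cvgM; exact: q11_continuous.
  - by apply: cvgM; [exact: q12_continuous|apply: cvgV => //; exact: q11_continuous].
pose D (M : R * R * R * R) := [/\ qdet M = 1, 0 < q11 M & q11 M < 1].
have sec : \forall g \near f x0', D (p g) -> f (q (p g)) = g.
  apply: (local_section tg lc (fc _) qc).
  near=> M => -[d1 M0 M1]; rewrite pf /= cos_atan_sqrt ?M0//.
  have n0 : q11 M != 0 by rewrite gt_eqF.
  apply: quad_eq; rewrite /q11 /q12 /q21 /q22/=; rewrite -/(q11 M) -/(q12 M) -/(q21 M) -/(q22 M).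
  - by [].
  - by field.
  - by field.
  - have -> : q22 M = (1 + q12 M * q21 M) / q11 M by rewrite -d1 /qdet; field.
    by field.
have pc : p @ f x0' --> p (f x0') by case: lc => + _ _ _ _; exact.
have nD : \forall g \near f x0', D (p g).
  have h1 : \forall M \near p (f x0'), 0 < q11 M by exact: (cvgr_gt _ q11c).
  have h2 : \forall M \near p (f x0'), q11 M < 1 by exact: (cvgr_lt _ q11c).
  have h3 := pc _ h1; have h4 := pc _ h2.
  near=> g; split; [by case: lc| |]; by near: g.
(* The hypotheses of [RT_gauss], made strict together with the time bound, hold at [x0'] and
   therefore near it. *)
pose good (u : R * R * R) := [/\ u.1.1 < 0, 0 < u.1.2, 0 < u.2 + u.1.2 * u.1.2 / u.1.1 &
  atan u.1.2 * u.1.2 / - u.1.1 + (u.2 + u.1.2 * u.1.2 / u.1.1) < T].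
have ngood : \forall u \near x0', good u.
  have k1 : (fun u : R * R * R => u.1.1) @ x0' --> - x by exact: (cvg_comp _ _ cvg_fst cvg_fst).
  have k2 : (fun u : R * R * R => u.1.2) @ x0' --> x * x by exact: (cvg_comp _ _ cvg_fst cvg_snd).
  have k3 : (fun u : R * R * R => u.2) @ x0' --> x * x * x + x by exact: cvg_snd.
  have nx0 : - x != 0 by rewrite oppr_eq0 gt_eqF.
  have k4 : (fun u : R * R * R => u.2 + u.1.2 * u.1.2 / u.1.1) @ x0' -->
      x * x * x + x + x * x * (x * x) / - x.
    by apply: cvgD k3 _; apply: cvgM; [exact: cvgM|exact: cvgV].
  have k5 : (fun u : R * R * R => atan u.1.2 * u.1.2 / - u.1.1 +
      (u.2 + u.1.2 * u.1.2 / u.1.1)) @ x0' --> atan (x * x) * (x * x) / - - x +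
      (x * x * x + x + x * x * (x * x) / - x).
    apply: cvgD k4; apply: cvgM; last by apply: cvgV; [rewrite oppr_eq0|exact: cvgN].
    by apply: cvgM => //; exact: (cvg_comp_at _ (@continuous_atan R _) k2).
  have e4 : x * x * x + x + x * x * (x * x) / - x = x by field; rewrite gt_eqF.
  have e5 : atan (x * x) * (x * x) / - - x = atan (x * x) * x by field; rewrite gt_eqF.
  rewrite e4 in k4; rewrite e4 e5 in k5.
  have n1 : \forall u \near x0', u.1.1 < 0.
    by apply: (cvgr_lt _ k1); rewrite oppr_lt0.
  have n2 : \forall u \near x0', 0 < u.1.2 by exact: (cvgr_gt _ k2).
  have n3 : \forall u \near x0', 0 < u.2 + u.1.2 * u.1.2 / u.1.1 by exact: (cvgr_gt _ k4).
  have n4 : \forall u \near x0', atan u.1.2 * u.1.2 / - u.1.1 +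
      (u.2 + u.1.2 * u.1.2 / u.1.1) < T.
    exact: (cvgr_lt _ k5 _ Tx).
  by near=> u; split; near: u.
have ngood' : \forall g \near f x0', good (q (p g)) by exact: (pc _ (qc _ ngood)).
change (\forall g \near f x0', RT T g); near=> g.
have Dg : D (p g) by near: g.
have <- : f (q (p g)) = g by move: Dg; near: g.
have [] : good (q (p g)) by near: g.
move: (q (p g)) => u u1 u2 u3 u4; rewrite /f.
by apply: RTle (RT_gauss u1 u2 (ltW u3)); exact: ltW.
Unshelve. all: end_near. Qed.

(** Near [gA d] the products [gB x ** gA t ** gB y] give a chart: [t] is the entry [q12], which
    stays positive, and division by it yields [x] and [y], whose signs do not matter. *)
Lemma near_upper_st_limit d : 0 < d -> \forall h \near gA d, st_limit h.
Proof.
move=> d0; pose f (x : R * R * R) := gB x.1.1 ** gA x.1.2 ** gB x.2.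
have fc : continuous f.
  move=> x; apply: (cvg_tgmul tg); [apply: (cvg_tgmul tg)|].
  - by apply: (cvg_comp_at gB (@gBc _)); exact: (cvg_comp _ _ cvg_fst cvg_fst).
  - by apply: (cvg_comp_at gA (@gAc _)); exact: (cvg_comp _ _ cvg_fst cvg_snd).
  - by apply: (cvg_comp_at gB (@gBc _)); exact: cvg_snd.
have f0 : f (0, d, 0) = gA d by rewrite /f /= gB0 (tg1l tg) (tg1r tg).
have pf u : p (f u) = (1 + u.1.2 * u.2, u.1.2,
    u.1.1 + u.2 + u.1.2 * u.1.1 * u.2, 1 + u.1.2 * u.1.1).
  rewrite !pM !pB pA.
  by apply: quad_eq; rewrite /qmul /lowerm /upperm /q11 /q12 /q21 /q22 /=; ring.
pose q (M : R * R * R * R) := ((q22 M - 1) / q12 M, q12 M, (q11 M - 1) / q12 M).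
have qf : q (p (f (0, d, 0))) = (0, d, 0).
  by rewrite pf /q /q11 /q12 /q22 /=; congr (_, _, _); field; rewrite gt_eqF.
have q12c : q12 M @[M --> p (f (0, d, 0))] --> d.
  have E : q12 (p (f (0, d, 0))) = d by rewrite pf.
  by rewrite -[X in _ --> X]E; exact: q12_continuous.
have qc : q M @[M --> p (f (0, d, 0))] --> (0, d, 0).
  rewrite -[X in _ --> X]qf.
  have n0 : q12 (p (f (0, d, 0))) != 0 by rewrite pf /q12/= gt_eqF.
  apply: triple_cvg.
  - apply: cvgM; last by apply: cvgV => //; exact: q12_continuous.
    by apply: cvgB; [exact: q22_continuous|exact: cvg_cst].
  - exact: q12_continuous.
  - apply: cvgM; last by apply: cvgV => //; exact: q12_continuous.
    by apply: cvgB; [exact: q11_continuous|exact: cvg_cst].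
have npos : \forall M \near p (f (0, d, 0)), 0 < q12 M by exact: (cvgr_gt _ q12c).
have sec : \forall g \near f (0, d, 0), qdet (p g) = 1 -> f (q (p g)) = g.
  apply: (local_section (D := fun M => qdet M = 1) tg lc (fc _) qc).
  near=> M => d1; have M0 : 0 < q12 M by near: M.
  have n0 : q12 M != 0 by rewrite gt_eqF.
  rewrite pf; apply: quad_eq; rewrite /q11 /q12 /q21 /q22/=; rewrite -/(q11 M) -/(q12 M) -/(q21 M) -/(q22 M).
  - by field.
  - by [].
  - have -> : q21 M = (q11 M * q22 M - 1) / q12 M by rewrite -d1 /qdet; field.
    by field.
  - by field.
have pc : p @ f (0, d, 0) --> p (f (0, d, 0)) by case: lc => + _ _ _ _; exact.
have npos' := pc _ npos.
rewrite f0 in npos' sec.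
near=> h.
have h0 : 0 < q12 (p h) by near: h.
have <- : f (q (p h)) = h by have : qdet (p h) = 1 by [case: lc]; near: h.
rewrite /f /=; apply: st_limitM; last exact: st_limit_lower.
by apply: st_limitM; [exact: st_limit_lower|apply: st_limit_upper; exact: ltW].
Unshelve. all: end_near. Qed.

(** The time is halved: [y] is interior to [RT (T / 2)], and so close to [e] that [gA d ** inv y] is
    still in [st_limit]. *)
Lemma st_limit_mul_upper g d : st_limit g -> 0 < d -> st_reach (g ** gA d).
Proof.
move=> gl d0 T T0; have T20 : 0 < T / 2 by rewrite divr_gt0.
have We : nbhs e (fun y => st_limit (gA d ** inv y)).
  have c : (fun y => gA d ** inv y) @ e --> gA d.
    have E : gA d ** inv e = gA d by rewrite -[LHS](tg1r tg) (tgKV tg).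
    rewrite -[X in _ --> X]E; apply: (cvg_tgmul tg); first exact: cvg_cst.
    by apply: (cvg_tginv tg); exact: cvg_id.
  exact: c _ (near_upper_st_limit d0).
have [y Wy yT] := RT_interior T20 We.
have -> : g ** gA d = g ** (gA d ** inv y) ** y by rewrite (tgA tg) (tgKV tg).
rewrite (splitr T); apply: (closure_mul_interior tg _ _ yT) => [u v|]; first exact: RTM.
exact: st_limitM.
Qed.

Lemma st_limit_closure : st_limit `<=` closure st_reach.
Proof.
move=> g gl.
have c : (fun d => g ** gA d) @ (0 : R) --> g ** gA 0.
  by apply: (cvg_tgmul tg); [exact: cvg_cst|exact: gAc].
rewrite gA0 (tg1r tg) in c.
apply: (closure_cvg_near (cvg_at_right_filter c)); near=> d.
by apply: st_limit_mul_upper => //; near: d; exact: nbhs_right_gt.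
Unshelve. all: end_near. Qed.

(** Here [g ** inv y] is in [st_limit] whatever [y] is, so any interior point [y] of [RT (T / 2)]
    will do. *)
Lemma st_limit_full : st_limit = setT -> st_reach = setT.
Proof.
move=> lT; apply/seteqP; split=> // g _ T T0.
have T20 : 0 < T / 2 by rewrite divr_gt0.
have [y _ yT] := RT_interior T20 filterT.
rewrite -(tgKV tg y g) (splitr T).
apply: (closure_mul_interior tg _ _ yT) => [u v|]; first exact: RTM.
by have : st_limit (g ** inv y) by [rewrite lT]; exact.
Qed.

(** * The elements over SO(2) ([rot_quad]) and the Iwasawa decomposition of G *)

Definition rot_quad (M : R * R * R * R) :=
  [/\ qdet M = 1, q11 M = q22 M & q21 M = - q12 M].

(** The angle is recovered as [atan (q12 / q11)], so [local_section] shows that near [e] the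
    elements over SO(2) all lie on [gK]. *)
Lemma near_rot eta : 0 < eta ->
  \forall g \near e, rot_quad (p g) -> exists2 th, `|th| < eta & g = gK th.
Proof.
move=> eta0.
pose q (M : R * R * R * R) := atan (q12 M / q11 M).
have pK0 : p (gK 0) = qone by rewrite gK0; case: lc.
have q11c : q11 M @[M --> p (gK 0)] --> (1 : R).
  have E : q11 (p (gK 0)) = 1 by rewrite pK0.
  by rewrite -[X in _ --> X]E; exact: q11_continuous.
have qc : q M @[M --> p (gK 0)] --> (0 : R).
  have E : atan (q12 (p (gK 0)) / q11 (p (gK 0))) = 0.
    by rewrite pK0 /q12 /q11 /= mul0r atan0.
  rewrite -[X in _ --> X]E.
  apply: (cvg_comp_at _ (@continuous_atan R _)).
  apply: cvgM; first exact: q12_continuous.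
  by apply: cvgV; [rewrite pK0 /q11 /= oner_neq0|exact: q11_continuous].
have npos : \forall M \near p (gK 0), 0 < q11 M by exact: (cvgr_gt _ q11c).
have sec : \forall g \near gK 0, rot_quad (p g) -> gK (q (p g)) = g.
  apply: (local_section tg lc (@gKc _) qc).
  near=> M => -[d1 Mdiag Moff]; have M0 : 0 < q11 M by near: M.
  have n0 : q11 M != 0 by rewrite gt_eqF.
  have c0 := cos_atan_gt0 (q12 M / q11 M); have c2 := cos_atan_sqr (q12 M / q11 M).
  (* Both sides are positive, and the determinant gives [q11 M ^+ 2 + q12 M ^+ 2 = 1]. *)
  have cE : cos (atan (q12 M / q11 M)) = q11 M.
    apply/eqP; rewrite -(eqrXn2 (n := 2)) ?ltW//.
    rewrite -(inj_eq (mulIf (_ : 1 + (q12 M / q11 M) ^+ 2 != 0))) ?c2; last first.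
      by rewrite gt_eqF// ltr_pwDl// sqr_ge0.
    by rewrite -[X in X == _]d1 /qdet -Mdiag Moff; apply/eqP; field.
  rewrite pK; apply: quad_eq; rewrite /rotm !quadE ?sin_atan cE//.
  - by rewrite divfK.
  - by rewrite divfK.
have nq : \forall M \near p (gK 0), `|q M| < eta.
  by apply: (cvgr_norm_lt _ qc); rewrite normr0.
have pc : p @ gK 0 --> p (gK 0) by case: lc => + _ _ _ _; exact.
have nq' : \forall g \near gK 0, `|q (p g)| < eta by exact: (pc _ nq).
rewrite gK0 in nq' sec.
near=> g => rg; exists (q (p g)); first by near: g.
by apply/esym; move: rg; near: g.
Unshelve. all: end_near. Qed.

(** In a product [K C B] the factor [B] fixes the second basis vector, so the second column has norm
    [e^k] with [k] the parameter of [C]; the inner product of the columns is then [e^(2k)] times the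
    parameter of [B]. *)
Definition nrm2 (g : G) := q12 (p g) ^+ 2 + q22 (p g) ^+ 2.
Definition diag_coord (g : G) := ln (nrm2 g) / 2.
Definition lower_coord (g : G) :=
  (q11 (p g) * q12 (p g) + q21 (p g) * q22 (p g)) / nrm2 g.
Definition rot_part (g : G) :=
  g ** inv (gC (diag_coord g) ** gB (lower_coord g)).

Lemma nrm2_gt0 g : 0 < nrm2 g.
Proof.
have : qdet (p g) = 1 by case: lc.
rewrite lt_neqAle addr_ge0 ?sqr_ge0// andbT => d1; apply/eqP => /esym/eqP.
rewrite paddr_eq0 ?sqr_ge0// !sqrf_eq0 => /andP[/eqP h1 /eqP h2].
by move/eqP: d1; rewrite /qdet h1 h2 mulr0 mul0r subrr eq_sym oner_eq0.
Qed.

Lemma continuous_nrm2 : continuous nrm2.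
Proof.
have [pc _ _ _ _] := lc => g.
by apply: cvgD; apply: cvgM; (apply: (cvg_comp_at _ _ (pc g));
  exact: q12_continuous || exact: q22_continuous).
Qed.

Lemma continuous_diag_coord : continuous diag_coord.
Proof.
move=> g; apply: cvgM; last exact: cvg_cst.
apply: (cvg_comp_at (@ln R)); first exact/continuous_ln/nrm2_gt0.
exact: continuous_nrm2.
Qed.

Lemma continuous_lower_coord : continuous lower_coord.
Proof.
have [pc _ _ _ _] := lc => g.
apply: cvgM; last by apply: cvgV; [rewrite gt_eqF ?nrm2_gt0|exact: continuous_nrm2].
apply: cvgD; apply: cvgM; apply: (cvg_comp_at _ _ (pc g)).
- exact: q11_continuous.
- exact: q12_continuous.
- exact: q21_continuous.
- exact: q22_continuous.
Qed.

Lemma continuous_rot_part : continuous rot_part.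
Proof.
move=> g; apply: (cvg_tgmul tg); first exact: cvg_id.
apply: (cvg_tginv tg); apply: (cvg_tgmul tg).
  by apply: (cvg_comp_at gC (@gCc _)); exact: continuous_diag_coord.
by apply: (cvg_comp_at gB (@gBc _)); exact: continuous_lower_coord.
Qed.

Lemma rot_quad_rot_part g : rot_quad (p (rot_part g)).
Proof.
have d1 : qdet (p g) = 1 by case: lc.
have N0 := nrm2_gt0 g.
have d2 : qdet (p (rot_part g)) = 1 by case: lc.
set k := diag_coord g; have Ek0 : expR k != 0 by rewrite gt_eqF// expR_gt0.
have Ek2 : expR k * expR k = nrm2 g by rewrite -expRD /k /diag_coord -splitr expR_lnK.
have Nn0 : nrm2 g != 0 by rewrite gt_eqF.
suff : [/\ q11 (p (rot_part g)) = q22 (p (rot_part g)) &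
           q21 (p (rot_part g)) = - q12 (p (rot_part g))] by case; split.
rewrite /rot_part pM (cover_inv tg lc) pM pC pB -/k.
rewrite /qmul /qadj /diagm /lowerm !quadE /lower_coord expRN.
have [h1 h2] := iwasawa_identity Ek0 Ek2 d1.
split.
- transitivity (q22 (p g) / expR k); last by ring.
  by rewrite -h1 /nrm2; ring.
- transitivity (- (q12 (p g) / expR k)); last by ring.
  by rewrite -h2 /nrm2; ring.
Qed.

Lemma iwasawa_continuous :
  continuous (fun x : R * R * R => gK x.1.1 ** (gC x.1.2 ** gB x.2)).
Proof.
move=> x; apply: (cvg_tgmul tg).
  by apply: (cvg_comp_at gK (@gKc _)); exact: (cvg_comp _ _ cvg_fst cvg_fst).
apply: (cvg_tgmul tg).
  by apply: (cvg_comp_at gC (@gCc _)); exact: (cvg_comp _ _ cvg_fst cvg_snd).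
by apply: (cvg_comp_at gB (@gBc _)); exact: cvg_snd.
Qed.

(** The quotient of the two rotation parts lies over SO(2) and tends to [e], so [near_rot] applies.
    This serves both the covering of [G] by [K C B] and the continuity of the angle. *)
Lemma near_rot_part g0 eta : 0 < eta -> \forall g \near g0,
  exists2 th, `|th| < eta & rot_part g = rot_part g0 ** gK th.
Proof.
move=> eta0.
have c : (fun g => inv (rot_part g0) ** rot_part g) @ g0 --> e.
  by apply: (cvg_tgmulV tg); [exact: cvg_cst|exact: continuous_rot_part].
have h := c _ (near_rot eta0).
near=> g.
have : rot_quad (p (inv (rot_part g0) ** rot_part g)) ->
    exists2 th, `|th| < eta & inv (rot_part g0) ** rot_part g = gK th by near: g.
case.
  have [d1 a1 b1] := rot_quad_rot_part g0; have [d2 a2 b2] := rot_quad_rot_part g.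
  split; first by case: lc.
  - rewrite pM (cover_inv tg lc) /qmul /qadj !quadE a1 b1 a2 b2; ring.
  - rewrite pM (cover_inv tg lc) /qmul /qadj !quadE a1 b1 a2 b2; ring.
by move=> th the E; exists th => //; rewrite -E (tgVK tg).
Unshelve. all: end_near. Qed.

Hypothesis Gconn : connected [set: G].

(** By [near_rot_part] membership in [S] is locally constant, so [S] is open and closed; it contains
    [e], and [G] is connected. *)
Lemma rot_part_onto g : exists th, rot_part g = gK th.
Proof.
pose S := [set g | exists th, rot_part g = gK th].
have loc g0 : \forall g \near g0, S g <-> S g0.
  near=> g1.
  have [th _ E] : exists2 th, `|th| < 1 & rot_part g1 = rot_part g0 ** gK th.
    by near: g1; exact: near_rot_part.
  split=> -[t tE]; last by exists (t + th); rewrite E tE gKD.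
  exists (t - th); rewrite gKD -tE E.
  by rewrite -(tgA tg) -gKD subrr gK0 (tg1r tg).
suff : S = setT by move=> /seteqP[_ /(_ g I)].
apply: Gconn.
- exists e; exists 0; rewrite gK0 /rot_part /diag_coord /lower_coord /nrm2.
  have -> : p e = qone by case: lc.
  rewrite /qone !quadE expr0n /= add0r expr1n ln1 !mul0r !mulr0 addr0 mul0r gC0 gB0.
  by rewrite (tg1r tg) (tgVr tg).
- exists S; rewrite ?setTI// openE => g0 Sg0; near=> g1.
  by have [_] : S g1 <-> S g0 by [near: g1; exact: loc]; apply.
- exists S; rewrite ?setTI// -openC openE => g0 Sg0; near=> g1 => Sg1; apply: Sg0.
  by have [+ _] : S g1 <-> S g0 by [near: g1; exact: loc]; apply.
Unshelve. all: end_near. Qed.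

Lemma iwasawa_onto g : exists x : R * R * R, gK x.1.1 ** (gC x.1.2 ** gB x.2) = g.
Proof.
have [th E] := rot_part_onto g.
by exists (th, diag_coord g, lower_coord g); rewrite /= -E (tgKV tg).
Qed.

Lemma simply_connected_of_rot_inj : (forall th, gK th = e -> th = 0) ->
  @simply_connected R G.
Proof.
move=> inj.
have [th thP] := choice rot_part_onto.
(* The angle [th] is obtained by choice; injectivity of [gK] forces [th g = th g0 + t] with the
   small [t] of [near_rot_part]. *)
have thc : continuous th.
  move=> g0; apply/cvgrPdist_lt => eta eta0; near=> g.
  have [t te] : exists2 t, `|t| < eta & rot_part g = rot_part g0 ** gK t.
    by near: g; exact: near_rot_part.
  rewrite !thP -gKD => E.
  suff -> : th g0 - th g = - t by rewrite normrN.
  have /inj : gK (th g - (th g0 + t)) = e by rewrite gKD E -gKD subrr gK0.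
  lra.
pose Th g := (th g, diag_coord g, lower_coord g).
pose Phi (x : R * R * R) := gK x.1.1 ** (gC x.1.2 ** gB x.2).
have PhiK g : Phi (Th g) = g by rewrite /Phi /= -thP (tgKV tg).
(* The loop is contracted along straight segments in the Iwasawa coordinates; its endpoints stay put
   because both have the coordinates of [gam 0]. *)
move=> gam gamc gam01.
pose conv (x y t : R) := (1 - t) * x + t * y.
pose H (st : R * R) := Phi (conv (th (gam st.1)) (th (gam 0)) st.2,
  conv (diag_coord (gam st.1)) (diag_coord (gam 0)) st.2,
  conv (lower_coord (gam st.1)) (lower_coord (gam 0)) st.2).
have conv0 x y : conv x y 0 = x by rewrite /conv; ring.
have conv1 x y : conv x y 1 = y by rewrite /conv; ring.
have convxx x t : conv x x t = x by rewrite /conv; ring.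
exists H; split.
- apply/subspace_continuousP => -[s t] [/= sI tI].
  have gc : (fun st => gam st.1) @ within (`[0, 1] `*` `[0, 1]) (nbhs (s, t)) --> gam s.
    have gs := (subspace_continuousP _ _).1 gamc s sI.
    apply: (cvg_comp fst gam _ gs) => W Ws.
    have : \forall st \near (s, t), `[0, 1]%classic st.1 -> W st.1.
      exact: (@cvg_fst _ _ (nbhs s) (nbhs t) _ (fun x => `[0, 1]%classic x -> W x) Ws).
    by apply: filterS => -[x y] /= h [xI _]; exact: h.
  have tc : (fun st => st.2) @ within (`[0, 1] `*` `[0, 1]) (nbhs (s, t)) --> t.
    by apply: cvg_within_filter; exact: cvg_snd.
  have convc (f : G -> R) : continuous f -> (fun st => conv (f (gam st.1)) (f (gam 0)) st.2) @
      within (`[0, 1] `*` `[0, 1]) (nbhs (s, t)) --> conv (f (gam s)) (f (gam 0)) t.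
    move=> fc; apply: cvgD.
      apply: cvgM; first by apply: cvgB; [exact: cvg_cst|exact: tc].
      by apply: (cvg_comp_at f _ gc); exact: fc.
    by apply: cvgM; [exact: tc|exact: cvg_cst].
  apply: (cvg_comp_at Phi (@iwasawa_continuous _)).
  apply: triple_cvg; apply: convc => //.
  + exact: continuous_diag_coord.
  + exact: continuous_lower_coord.
- by move=> s; rewrite /H /= !conv0 -[RHS]PhiK.
- by move=> s; rewrite /H /= !conv1 -[RHS]PhiK.
- by move=> t; rewrite /H /= -gam01 !convxx; split; exact: PhiK.
Unshelve. all: end_near. Qed.

Lemma st_reach_full : ~ @simply_connected R G -> st_reach = setT.
Proof.
move=> nsc; apply: st_limit_full; apply/seteqP; split=> // g _.
have [th [the th0]] : exists th, gK th = e /\ 0 < th.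
  have [th the thn0] : exists2 th, gK th = e & th <> 0.
    apply: contrapT => h; apply: nsc; apply: simply_connected_of_rot_inj => th the.
    by apply: contrapT => thn0; apply: h; exists th.
  have [th0|th0|//] := ltrgt0P th; first by exists th.
  exists (- th); split; last by rewrite oppr_gt0.
  by rewrite -[LHS](tg1l tg) -the -gKD subrr gK0.
have period n t : gK (t + th *+ n) = gK t.
  elim: n => [|n IH]; first by rewrite mulr0n addr0.
  by rewrite mulrSr addrA gKD IH the (tg1r tg).
have [x <-] := iwasawa_onto g.
apply: st_limitM; last by apply: st_limitM; [exact: st_limit_diag|exact: st_limit_lower].
(* Enough periods are added to make the angle nonnegative. *)
rewrite -(period (Num.bound (`|x.1.1| / th))); apply: st_limit_rot.
have := @archi_boundP _ (`|x.1.1| / th) (divr_ge0 (normr_ge0 _) (ltW th0)).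
rewrite ltr_pdivrMr// mulr_natl; have := ler_norm (- x.1.1); rewrite normrN; lra.
Qed.

End Reach.

(** * Matrix exponentials and coordinates *)

Section Exponential.
Variable R : realType.
Implicit Types (J N : 'M[R]_2) (t : R).

(** This reduces the matrix series to two scalar ones: cosine and sine along [1] and [J], or two
    exponentials along the spectral projections. *)
Lemma expm_cvg (A B C : 'M[R]_2) (x y : R ^nat) (u v : R) :
  (forall k, (k`!%:R^-1 : R) *: A ^+ k = x k *: B + y k *: C) ->
  series x @ \oo --> u -> series y @ \oo --> v -> expm A = u *: B + v *: C.
Proof.
move=> AE xu yv; rewrite /expm.
have -> : (fun n : nat => \sum_(0 <= k < n) ((k`!)%:R^-1 : R) *: A ^+ k) =
    (fun n => series x n *: B + series y n *: C).
  apply/funext => n; rewrite /series /= !scaler_suml -big_split /=.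
  by apply: eq_bigr => k _; exact: AE.
apply: cvg_lim; first exact: norm_hausdorff.
by apply: cvgD; exact: cvgZr_tmp.
Qed.

Lemma expm_nilpotent N : N * N = 0 -> expm N = 1 + N.
Proof.
move=> N2; rewrite /expm; apply: lim_near_cst; first exact: norm_hausdorff.
exists 2%N => // -[//|[//|n]] _ /=.
rewrite big_nat_recl// big_nat_recl//= fact0 factS fact0 muln1 invr1 !scale1r expr0 expr1.
rewrite big1 ?addr0// => i _.
by rewrite !exprS mulrA N2 mul0r scaler0.
Qed.

Lemma expm_elliptic J t : J * J = -1 -> expm (t *: J) = cos t *: 1 + sin t *: J.
Proof.
move=> J2; apply: (@expm_cvg _ _ _ (cos_coeff t) (sin_coeff t)).
- move=> k; rewrite /cos_coeff /sin_coeff /= exprZn scalerA.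
  (* The exponents [k./2] and [k.-1./2] are those of [cos_coeff] and [sin_coeff]; the parity factor
     kills the one that does not apply. *)
  have -> : J ^+ k = (~~ odd k)%:R *: ((-1) ^+ k./2 *: 1) + (odd k)%:R *: ((-1) ^+ k.-1./2 *: J).
    have Jeven m : J ^+ m.*2 = (-1) ^+ m *: 1.
      rewrite -muln2 mulnC exprM expr2 J2; elim: m => [|m IH]; first by rewrite !expr0 scale1r.
      by rewrite !exprS IH mulN1r mulN1r scaleNr.
    rewrite -{1}(odd_double_half k); case: (boolP (odd k)) => ok.
      rewrite add1n exprS Jeven scale0r add0r scale1r -scalerAr mulr1; congr (_ *: _).
      by congr (_ ^+ _); rewrite -{2}(odd_double_half k) ok add1n /= doubleK.
    by rewrite add0n Jeven scale1r scale0r addr0.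
  rewrite scalerDr !scalerA -exprnP.
  by congr (_ *: _ + _ *: _); ring.
- by rewrite unlock; exact: is_cvg_series_cos_coeff.
- by rewrite unlock; exact: is_cvg_series_sin_coeff.
Qed.

Lemma expm_hyperbolic J t : J * J = 1 -> expm (t *: J) = ch t *: 1 + sh t *: J.
Proof.
(* [P] and [Q] are the spectral projections of [J] for the eigenvalues 1 and -1. *)
move=> J2; pose P : 'M[R]_2 := 2^-1 *: (1 + J); pose Q : 'M[R]_2 := 2^-1 *: (1 - J).
rewrite (@expm_cvg _ P Q (exp_coeff t) (exp_coeff (- t)) (expR t) (expR (- t))).
- rewrite /P /Q !scalerA !scalerDr /ch /sh scalerN -scaleNr addrACA -!scalerDl.
  by congr (_ *: _ + _ *: _); ring.
- move=> k; rewrite /exp_coeff /= exprZn scalerA.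
  have JP : J * P = P by rewrite -scalerAr mulrDr J2 mulr1 addrC.
  have JQ : J * Q = - Q by rewrite -scalerAr mulrBr J2 mulr1 -scalerN opprB.
  have PQ : P + Q = 1 by rewrite /P /Q; apply/matrixP => i j; rewrite !mxE; field.
  clearbody P Q.
  have -> : J ^+ k = P + (-1) ^+ k *: Q.
    elim: k => [|k IH]; first by rewrite !expr0 scale1r PQ.
    by rewrite exprS IH mulrDr JP -scalerAr JQ exprS mulN1r scaleNr scalerN.
  rewrite scalerDr scalerA; congr (_ *: _ + _ *: _); first by ring.
  by rewrite -[(- t)]mulN1r exprMn; ring.
- exact: is_cvg_series_exp_coeff.
- exact: is_cvg_series_exp_coeff.
Qed.

End Exponential.

(** * Trace identities and the relations between a, b and c *)

Section Coordinates.
Variable R : realType.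
Local Notation quad := (R * R * R * R)%type.
Implicit Types X Y M : 'M[R]_2.

Lemma sum2 (F : 'I_2 -> R) : \sum_i F i = F 0 + F 1.
Proof. by rewrite !big_ord_recl big_ord0 addr0; congr (F _ + F _); exact: val_inj. Qed.

Lemma ord2P (i : 'I_2) : i = 0 \/ i = 1.
Proof. by case: i => [[|[|//]] h]; [left|right]; exact: val_inj. Qed.

Lemma mxtrace2 X : \tr X = X 0 0 + X 1 1.
Proof. exact: sum2. Qed.

Lemma mul2E X Y i j : (X * Y) i j = X i 0 * Y 0 j + X i 1 * Y 1 j.
Proof. by rewrite -mulmxE mxE sum2. Qed.

(** The Cayley-Hamilton identity in dimension 2, polarized. *)
Lemma polar_cayley X Y : X * Y + Y * X =
  \tr X *: Y + \tr Y *: X + (\tr (X * Y) - \tr X * \tr Y) *: 1.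
Proof.
apply/matrixP => i j; rewrite !mxtrace2 !mul2E !mxE !sum2.
by case: (ord2P i) => ->; case: (ord2P j) => -> /=; ring.
Qed.

Lemma det2 X : \det X = X 0 0 * X 1 1 - X 0 1 * X 1 0.
Proof.
rewrite (expand_det_row _ 0) sum2 /cofactor !det_mx11 !mxE /=.
have -> : lift 0 0 = 1 :> 'I_2 by exact: val_inj.
have -> : lift 1 0 = 0 :> 'I_2 by exact: val_inj.
by rewrite expr0 expr1; ring.
Qed.

Lemma det_mxtrace X : 2 * \det X = \tr X ^+ 2 - \tr (X * X).
Proof. by rewrite det2 !mxtrace2 !mul2E; ring. Qed.

Lemma mxtrace_mulrC X Y : \tr (X * Y) = \tr (Y * X).
Proof. by rewrite -!mulmxE mxtrace_mulC. Qed.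

(** The square of a traceless [X] is scalar, so it commutes with [Y]; if [[X, Y] = s X] with [s]
    nonzero, then [0 = [X^2, Y] = 2 s X^2]. Next [ab + ba] is the scalar [tr (ab)], and [[a, c] = 2
    aba = 2 tr (ab) a] makes it 1, as [a] is nonzero. *)
Lemma sl2_relations (a b c : 'M[R]_2) : sl2_basis a b c ->
  [/\ a * a = 0, b * b = 0, a * b + b * a = 1 & c = b * a - a * b].
Proof.
move=> [[ta tb tc] [free [ba ac bc]]]; rewrite /lieb in ba ac bc.
have sq X : \tr X = 0 -> X * X = (\tr (X * X) / 2) *: 1.
  move=> tX; have := polar_cayley X X; rewrite tX !scale0r !add0r mul0r subr0 => h.
  apply: (@scalerI _ _ 2); first by rewrite pnatr_eq0.
  by rewrite scalerA mulrC divfK ?pnatr_eq0// -h scaler_nat mulr2n.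
have nil X Y (s : R) : s != 0 -> \tr X = 0 -> X * Y - Y * X = s *: X -> X * X = 0.
  move=> s0 tX XY.
  have : X * (X * Y - Y * X) + (X * Y - Y * X) * X = (s + s) *: (X * X).
    by rewrite XY -scalerAr -scalerAl scalerDl.
  rewrite mulrBr mulrBl !mulrA addrA subrK -[Y * X * X]mulrA (sq X tX).
  rewrite -scalerAl -scalerAr mul1r mulr1 subrr => /esym/eqP.
  rewrite scalerA scaler_eq0 => /orP[/eqP h|/eqP ->]; last by rewrite scaler0.
  have ss0 : s + s != 0 by rewrite -mulr2n mulrn_eq0.
  by move/eqP: h; rewrite mulf_eq0 (negbTE ss0) => /eqP ->; rewrite scale0r.
have a2 : a * a = 0 by apply: (nil a c 2) => //; rewrite pnatr_eq0.
have b2 : b * b = 0.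
  by apply: (nil b c (- 2)); rewrite ?oppr_eq0 ?pnatr_eq0// bc scaleNr.
have ab : a * b + b * a = \tr (a * b) *: 1.
  by rewrite polar_cayley ta tb !scale0r !add0r mul0r subr0.
split=> //; rewrite ab.
have a0 : a <> 0.
  by move=> a0; have [] := free 1 0 0; rewrite ?a0 ?scaler0 ?scale0r ?addr0// => /eqP; rewrite oner_eq0.
have aba : a * b * a = \tr (a * b) *: a.
  have := congr1 (fun M => M * a) ab => /=.
  by rewrite mulrDl -[b * a * a]mulrA a2 mulr0 addr0 -scalerAl mul1r.
move: ac; rewrite -ba mulrBr mulrBl !mulrA a2 mul0r subr0.
rewrite -[b * a * a]mulrA a2 mulr0 sub0r opprK aba -scalerDl => /eqP.
rewrite -subr_eq0 -scalerBl scaler_eq0 => /orP[/eqP h|/eqP //].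
have -> : \tr (a * b) = 1 by lra.
by rewrite scale1r.
Qed.

End Coordinates.

(** Multiply [polar_cayley] for the idempotent [Y * X] and [M] by [X] on the left and [Y] on the
    right. *)
Lemma mul_mxtrace_mid (R : realType) (X Y M : 'M[R]_2) :
  X * Y * X = X -> Y * X * Y = Y -> \tr (Y * X) = 1 ->
  X * M * Y = \tr (Y * X * M) *: (X * Y).
Proof.
move=> XYX YXY tYX.
have := congr1 (fun Z => X * Z * Y) (polar_cayley (Y * X) M) => /=.
rewrite tYX scale1r !mulrDr !mulrDl mul1r -!scalerAr -!scalerAl !mulrA mulr1 XYX.
rewrite -[X * M * Y * X * Y]mulrA -[X * M * Y * (X * Y)]mulrA [Y * (X * Y)]mulrA YXY.
by rewrite -addrA => /addrI ->; rewrite -scalerDl addrCA subrr addr0.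
Qed.

(** * Coordinates in the matrix units ab, a, b, ba *)

Section MatrixUnits.
Variables (R : realType) (a b : 'M[R]_2).
Local Notation quad := (R * R * R * R)%type.
Implicit Types (M : 'M[R]_2) (N : quad).
Hypothesis a2 : a * a = 0.
Hypothesis b2 : b * b = 0.
Hypothesis abD : a * b + b * a = 1.

Definition of_quad N : 'M[R]_2 :=
  q11 N *: (a * b) + q12 N *: a + q21 N *: b + q22 N *: (b * a).
(** Under the trace pairing [a] and [b] are dual to each other, hence the exchange of the two middle
    entries. *)
Definition to_quad M : quad :=
  (\tr (a * b * M), \tr (b * M), \tr (a * M), \tr (b * a * M)).

Lemma aba : a * b * a = a.
Proof. by rewrite -[RHS]mul1r -abD mulrDl -[b * a * a]mulrA a2 mulr0 addr0. Qed.

Lemma bab : b * a * b = b.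
Proof. by rewrite -[RHS]mul1r -abD mulrDl -[a * b * b]mulrA b2 mulr0 add0r. Qed.

(** Cayley-Hamilton times [X] leaves [(tr X)^2 X = 0]; its trace is [(tr X)^3 = 0]. *)
Lemma mxtrace_nilp (X : 'M[R]_2) : X * X = 0 -> \tr X = 0.
Proof.
move=> X2; have := polar_cayley X X.
rewrite X2 addr0 mxtrace0 sub0r => /(congr1 (fun M => \tr (M * X))).
rewrite mul0r mxtrace0 !mulrDl -!scalerAl X2 !scaler0 mul1r !add0r.
rewrite mxtraceZ => /esym/eqP.
by rewrite mulf_eq0 oppr_eq0 mulf_eq0 => /orP[/orP[]|] /eqP.
Qed.

Let ta : \tr a = 0. Proof. exact: mxtrace_nilp. Qed.
Let tb : \tr b = 0. Proof. exact: mxtrace_nilp. Qed.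

Lemma mxtrace_ab : \tr (a * b) = 1.
Proof.
have := congr1 mxtrace abD; rewrite mxtraceD (mxtrace_mulrC b a).
by rewrite mxtrace1 => h; lra.
Qed.

Lemma of_quad1 : of_quad qone = 1.
Proof. by rewrite /of_quad /qone !quadE !scale0r !scale1r !addr0 abD. Qed.

Lemma of_quadM N N' : of_quad (qmul N N') = of_quad N * of_quad N'.
Proof.
rewrite /of_quad /qmul !quadE !mulrDl !mulrDr -!scalerAl -!scalerAr !mulrA.
have abb : a * b * b = 0 by rewrite -mulrA b2 mulr0.
have baa : b * a * a = 0 by rewrite -mulrA a2 mulr0.
rewrite !(aba, bab, abb, baa, a2, b2, mul0r, scaler0, addr0, add0r) !scalerA.
by apply/matrixP => i j; rewrite !mxE !sum2; ring.
Qed.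

(** Split [M = abM + baM]. Polarization moves the inner factor past [M] ([half]), and the resulting
    [aMb] and [bMa] are multiples of [ab] and [ba] by [mul_mxtrace_mid]. *)
Lemma to_quadK M : of_quad (to_quad M) = M.
Proof.
have tba : \tr (b * a) = 1 by rewrite (mxtrace_mulrC b a) mxtrace_ab.
have trM : \tr M = \tr (a * b * M) + \tr (b * a * M).
  by rewrite -mxtraceD -mulrDl abD mul1r.
have aMb := mul_mxtrace_mid M aba bab tba.
have bMa := mul_mxtrace_mid M bab aba mxtrace_ab.
have half (X Y : 'M[R]_2) : \tr X = 0 -> \tr Y = 0 ->
    Y * X * M = \tr M *: (Y * X) + \tr (X * M) *: Y - Y * M * X.
  move=> tX tY; apply/esym/eqP; rewrite subr_eq -!mulrA -mulrDr polar_cayley tX.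
  by rewrite scale0r add0r mul0r subr0 mulrDr -!scalerAr mulr1.
rewrite -[RHS]mul1r -abD mulrDl (half b a)// (half a b)// aMb bMa trM /of_quad /to_quad !quadE.
by apply/matrixP => i j; rewrite !mxE !sum2; ring.
Qed.

Lemma of_quadK N : to_quad (of_quad N) = N.
Proof.
have tba : \tr (b * a) = 1 by rewrite (mxtrace_mulrC b a) mxtrace_ab.
have tab := mxtrace_ab.
have abb : a * b * b = 0 by rewrite -mulrA b2 mulr0.
have baa : b * a * a = 0 by rewrite -mulrA a2 mulr0.
apply: quad_eq; rewrite /to_quad /of_quad !quadE !mulrDr -!scalerAr !mulrA;
by rewrite ?(aba, bab, abb, baa, a2, b2, mul0r, scaler0, addr0, add0r, mxtraceD,
             mxtraceZ, mxtrace0, ta, tb, tab, tba, mulr0, mulr1).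
Qed.

Lemma of_quad_inj : injective of_quad.
Proof. exact: can_inj of_quadK. Qed.

Lemma to_quadM M M' : to_quad (M * M') = qmul (to_quad M) (to_quad M').
Proof. by apply: of_quad_inj; rewrite of_quadM !to_quadK. Qed.

Lemma to_quad1 : to_quad 1 = qone.
Proof. by rewrite -of_quad1 of_quadK. Qed.

Lemma mxtrace_of_quad N : \tr (of_quad N) = q11 N + q22 N.
Proof.
have tba : \tr (b * a) = 1 by rewrite (mxtrace_mulrC b a) mxtrace_ab.
by rewrite /of_quad !mxtraceD !mxtraceZ mxtrace_ab ta tb tba; ring.
Qed.

Lemma det_to_quad M : \det M = qdet (to_quad M).
Proof.
have := det_mxtrace M; rewrite -{2 3 4}(to_quadK M) -of_quadM !mxtrace_of_quad.
by rewrite /qdet /qmul !quadE; lra.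
Qed.

Lemma mxtrace_mull_continuous (X : 'M[R]_2) : continuous (fun M => \tr (X * M)).
Proof.
have -> : (fun M => \tr (X * M)) = (fun M : 'M[R]_2 => X 0 0 * M 0 0 + X 0 1 * M 1 0 +
    (X 1 0 * M 0 1 + X 1 1 * M 1 1)).
  by apply/funext => M; rewrite mxtrace2 !mul2E.
have lin (T : topologicalType) (f g h k : T -> R) (x y z w : R) :
    continuous f -> continuous g -> continuous h -> continuous k ->
    continuous (fun t => x * f t + y * g t + (z * h t + w * k t)).
  move=> fc gc hc kc t; apply: cvgD; apply: cvgD; apply: cvgM; try exact: cvg_cst.
  - exact: fc.
  - exact: gc.
  - exact: hc.
  - exact: kc.
by apply: lin; exact: coord_continuous.
Qed.

Lemma to_quad_continuous : continuous to_quad.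
Proof.
have quadc (T : topologicalType) (f g h k : T -> R) :
    continuous f -> continuous g -> continuous h -> continuous k ->
    continuous (fun t => (f t, g t, h t, k t)).
  by move=> fc gc hc kc t; apply: quad_cvg; [exact: fc|exact: gc|exact: hc|exact: kc].
by apply: quadc; exact: mxtrace_mull_continuous.
Qed.

Lemma of_quad_continuous : continuous of_quad.
Proof.
move=> N; apply: cvgD; [apply: cvgD; [apply: cvgD|]|]; apply: cvgZr_tmp.
- exact: q11_continuous.
- exact: q12_continuous.
- exact: q21_continuous.
- exact: q22_continuous.
Qed.

Lemma expm_upper t : expm (t *: a) = of_quad (upperm t).
Proof.
rewrite expm_nilpotent; last by rewrite -scalerAl -scalerAr a2 !scaler0.
rewrite -abD /of_quad /upperm !quadE.
by apply/matrixP => i j; rewrite !mxE !sum2; ring.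
Qed.

Lemma expm_lower t : expm (t *: b) = of_quad (lowerm t).
Proof.
rewrite expm_nilpotent; last by rewrite -scalerAl -scalerAr b2 !scaler0.
rewrite -abD /of_quad /lowerm !quadE.
by apply/matrixP => i j; rewrite !mxE !sum2; ring.
Qed.

(** The sign of [x * y], hence of the control, decides between elliptic and hyperbolic pieces. *)
Lemma sqr_lin x y : (x *: a + y *: b) * (x *: a + y *: b) = (x * y) *: 1.
Proof.
rewrite -abD mulrDl !mulrDr -!scalerAl -!scalerAr a2 b2 !scaler0 add0r addr0 !scalerA.
by rewrite scalerDr [y * x]mulrC.
Qed.

Lemma expm_ell w t : w != 0 -> expm (t *: (w^-1 *: a - w *: b)) = of_quad (ellm w t).
Proof.
move=> w0; rewrite expm_elliptic; last first.
  by rewrite -scaleNr sqr_lin mulrN mulVf// scaleN1r.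
rewrite -abD /of_quad /ellm !quadE.
by apply/matrixP => i j; rewrite !mxE !sum2; ring.
Qed.

Lemma expm_hyp w t : w != 0 -> expm (t *: (w^-1 *: a + w *: b)) = of_quad (hypm w t).
Proof.
move=> w0; rewrite expm_hyperbolic; last by rewrite sqr_lin mulVf// scale1r.
rewrite -abD /of_quad /hypm !quadE.
by apply/matrixP => i j; rewrite !mxE !sum2; ring.
Qed.

Lemma expm_rot t : expm (t *: (a - b)) = of_quad (rotm t).
Proof. by rewrite rotmE -expm_ell ?oner_neq0// invr1 !scale1r. Qed.

Lemma expm_diag t : expm (t *: (b * a - a * b)) = of_quad (diagm t).
Proof.
rewrite expm_hyperbolic; last first.
  rewrite mulrBl !mulrBr !mulrA aba bab.
  rewrite -[a * b * b]mulrA -[b * a * a]mulrA a2 b2 !mulr0 !mul0r sub0r subr0 opprK.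
  by rewrite addrC abD.
rewrite -abD /of_quad /diagm !quadE /ch /sh.
by apply/matrixP => i j; rewrite !mxE !sum2; field.
Qed.

End MatrixUnits.

(** * From the matrix-valued covering to coordinates *)

Section Transfer.
Variables (R : realType) (G : topologicalType).
Variables (mul : G -> G -> G) (inv : G -> G) (e : G).
Variables (p : G -> 'M[R]_2) (a b : 'M[R]_2).
Hypothesis tg : topological_group mul inv e.
Hypothesis cov : covering_hom_SL2 mul e p.
Hypothesis a2 : a * a = 0.
Hypothesis b2 : b * b = 0.
Hypothesis abD : a * b + b * a = 1.

Definition pquad (g : G) := to_quad a b (p g).

Lemma pquadK g : of_quad a b (pquad g) = p g.
Proof. exact: to_quadK. Qed.

Lemma local_cover_pquad : local_cover mul e pquad.
Proof.
have [[pSL _ pM p1] [pc cover]] := cov.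
split.
- by move=> g; apply: (cvg_comp_at (to_quad a b)); [exact: to_quad_continuous|exact: pc].
- by move=> x y; rewrite /pquad pM to_quadM.
- by rewrite /pquad p1 to_quad1.
- by move=> x; rewrite -det_to_quad//; exact: pSL.
have SL1 : SL2 (1 : 'M[R]_2) by rewrite /SL2 /= det1.
have [U [Uo [U1 [I [V [[Vo pU _] [Vinj _ Vopen]]]]]]] := cover 1 SL1.
(* The sheet [V i] through [e] yields both local injectivity and openness at [e]. *)
have [i _ Vie] : (\bigcup_i V i) e by rewrite -pU /= p1.
have Ve : nbhs e (V i) by apply: open_nbhs_nbhs; split=> //; exact: Vo.
split.
  exists (V i) => // x y Vx Vy pxy; apply: (Vinj i) => //.
  by rewrite -[LHS]pquadK pxy pquadK.
move=> W We.
have [U' [U'o pWU]] : exists U', open U' /\ p @` (W° `&` V i) = U' `&` SL2 (R := R).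
  apply: (Vopen i); last by move=> x [].
  by apply: openI; [exact: open_interior|exact: Vo].
have U'1 : U' 1.
  have : (p @` (W° `&` V i)) 1.
    by exists e => //; split=> //; exact: nbhs_singleton (nbhs_interior We).
  by rewrite pWU => -[].
have nU : nbhs (of_quad a b qone) U'.
  by rewrite of_quad1//; apply: open_nbhs_nbhs.
have nN := of_quad_continuous nU.
near=> N => N1; have U'N : U' (of_quad a b N) by near: N; exact: nN.
have : (U' `&` SL2 (R := R)) (of_quad a b N).
  split=> //; rewrite /SL2 /= (det_to_quad a2 b2 abD) of_quadK//.
rewrite -pWU => -[g [Wg _] pg]; exists g; first exact: interior_subset Wg.
by rewrite /pquad pg of_quadK.
Unshelve. all: end_near. Qed.

Let lc := local_cover_pquad.

Lemma lift_is_expG X rho gam v : (forall t, expm (t *: X) = of_quad a b (rho t)) ->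
  lifts e pquad rho gam -> is_expG e p (v *: X) (gam v).
Proof.
move=> XE [gc g0 pg]; exists (fun t => gam (t * v)); split.
- move=> t; apply: (cvg_comp_at gam); first exact: gc.
  by apply: cvgM; [exact: cvg_id|exact: cvg_cst].
- by rewrite mul0r.
- by move=> t; rewrite scalerA XE -pg pquadK.
- by rewrite mul1r.
Qed.

(** Uniqueness of lifts makes the exponential of [v *: X] in [G] single-valued. *)
Lemma is_expG_lift X rho gam v g : (forall t, expm (t *: X) = of_quad a b (rho t)) ->
  lifts e pquad rho gam -> is_expG e p (v *: X) g -> g = gam v.
Proof.
move=> XE [gc g0 pg] [f [fc f0 pf <-]].
suff -> : f = (fun t => gam (t * v)) by rewrite mul1r.
apply: (lift_unique tg lc) => //.
- move=> t; apply: (cvg_comp_at gam); first exact: gc.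
  by apply: cvgM; [exact: cvg_id|exact: cvg_cst].
- by move=> t; rewrite pg /pquad pf scalerA XE of_quadK.
- by rewrite mul0r f0 g0.
Qed.

Lemma reach_piece t u g : 0 <= t -> is_expG e p (t *: (a + u *: b)) g ->
  reach_le mul e p a b t g.
Proof.
move=> t0 gE; exists [:: (t, u, g)]; split.
- by move=> x; rewrite inE => /eqP ->.
- by rewrite big_seq1.
- by rewrite /= (tg1r tg).
Qed.

Lemma reach_system_reach_le gA : lifts e pquad (@upperm R) gA ->
  reach_system mul e pquad gA (reach_le mul e p a b).
Proof.
move=> lA; split.
- by exists [::]; split=> //; rewrite big_nil.
- by move=> T T' g TT' [s [sP sT gE]]; exists s; split=> //; exact: le_trans TT'.
- move=> T T' x y [s [sP sT xE]] [s' [sP' sT' yE]]; exists (s ++ s'); split.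
  + by move=> z; rewrite mem_cat => /orP[/sP|/sP'].
  + by rewrite big_cat /= lerD.
  + rewrite xE yE; elim: s {sP sT xE} => [|z s IH] /=; first by rewrite (tg1l tg).
    by rewrite -(tgA tg) IH.
split.
- move=> t t0; apply: (@reach_piece _ 0) => //; rewrite scale0r addr0.
  by apply: (lift_is_expG (rho := @upperm R)) => // s; exact: expm_upper.
- move=> w t gam w0 t0 lgam; apply: (@reach_piece _ (- (w * w))); first by rewrite divr_ge0// ltW.
  have wn0 : w != 0 by rewrite gt_eqF.
  have -> : (t / w) *: (a + - (w * w) *: b) = t *: (w^-1 *: a - w *: b).
    by apply/matrixP => i j; rewrite !mxE; field.
  by apply: lift_is_expG lgam => s; exact: expm_ell.
- move=> w t gam w0 t0 lgam; apply: (@reach_piece _ (w * w)); first by rewrite divr_ge0// ltW.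
  have wn0 : w != 0 by rewrite gt_eqF.
  have -> : (t / w) *: (a + (w * w) *: b) = t *: (w^-1 *: a + w *: b).
    by apply/matrixP => i j; rewrite !mxE; field.
  by apply: lift_is_expG lgam => s; exact: expm_hyp.
Qed.

End Transfer.

Theorem theorem5 (R : realType) (G : topologicalType)
  (mul : G -> G -> G) (inv : G -> G) (e : G) (p : G -> 'M[R]_2)
  (a b c : 'M[R]_2) :
  topological_group mul inv e ->
  connected [set: G] ->
  covering_hom_SL2 mul e p ->
  sl2_basis a b c ->
  [/\ good_bracket mul e p a b b,
      good_bracket mul e p a b c,
      (forall t1 : R, 0 <= t1 -> forall g : G,
          is_expG e p (t1 *: (a - b)) g -> st_approx_reachable mul e p a b g) &
      (~ @simply_connected R G -> st_controllable mul e p a b)].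
Proof.
move=> tg Gconn cov /sl2_relations[a2 b2 abD cE].
have lc := local_cover_pquad cov a2 b2 abD.
have [gA lA] := lifts_exist tg lc (@one_param_upperm R).
have [gB lB] := lifts_exist tg lc (@one_param_lowerm R).
have [gC lC] := lifts_exist tg lc (@one_param_diagm R).
have [gK lK] := lifts_exist tg lc (@one_param_rotm R).
have rs := reach_system_reach_le tg a2 b2 abD lA.
(* For this system [st_reach] unfolds to [Ast], so the closure here is that of
   [st_approx_reachable]. *)
have approx := st_limit_closure tg lc lA lB lC rs.
split.
- move=> v g /(is_expG_lift tg cov a2 b2 abD (expm_lower b2 abD) lB) ->.
  exact/approx/(st_limit_lower tg lc lA lB lC rs).
- rewrite cE => v g /(is_expG_lift tg cov a2 b2 abD (expm_diag a2 b2 abD) lC) ->.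
  exact/approx/(st_limit_diag tg lc lA lB lC rs).
- move=> t1 t10 g /(is_expG_lift tg cov a2 b2 abD (expm_rot a2 b2 abD) lK) ->.
  exact/approx/(st_limit_rot tg lc lA lB lC lK rs).
- move=> nsc; exact: (st_reach_full tg lc lA lB lC lK rs Gconn nsc).
Qed.
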